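(* Let $X$ be a set, $\Omega$ a nonempty set disjoint from $X$, and $\lambda_\Omega=(\lambda_\omega)_{\omega\in\Omega}$ a family of elements of $\mathbf{k}$. Let $j_X:X\hookrightarrow\mathrm{Sha}^{NC}_{RT}(X,\Omega)$, $x\mapsto\bullet_x$, be the natural embedding. Then the triple $(\mathrm{Sha}^{NC}_{RT}(X,\Omega),\,\diamond_\ell,\,(B_\omega^+)_{\omega\in\Omega})$ together with $j_X$ is the free matching Rota-Baxter algebra of weight $\lambda_\Omega$ on $X$. Further, $\mathrm{Sha}^{NC}_{RT}(X,\Omega)$ with $\mathbf{k}\mathfrak{L}_{(n)}$, $n\ge0$, is an $\Omega$-operated filtered algebra and $\psi:\mathbf{k}\mathcal{F}(X,\Omega)\to\mathrm{Sha}^{NC}_{RT}(X,\Omega)$ is a homomorphism of $\Omega$-operated filtered algebras.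
   Context: $\mathbf{k}$ is a fixed unitary commutative ring; algebras are unitary associative $\mathbf{k}$-algebras. A matching Rota-Baxter algebra of weight $\lambda_\Omega$ is an algebra $R$ with linear operators $P_\omega:R\to R$, $\omega\in\Omega$, such that $P_\alpha(x)P_\beta(y)=P_\alpha(xP_\beta(y))+P_\beta(P_\alpha(x)y)+\lambda_\beta P_\alpha(xy)$ for all $x,y\in R$, $\alpha,\beta\in\Omega$; homomorphisms are algebra homomorphisms commuting with the operators. The free one on $X$ is such an algebra $R$ with a map $j_X:X\to R$ such that every set map from $X$ to a matching Rota-Baxter algebra of weight $\lambda_\Omega$ factors through $j_X$ by a unique homomorphism. An $\Omega$-operated algebra is an algebra $R$ with linear operators $P_\omega:R\to R$, $\omega\in\Omega$. With an increasing filtration $\{R_n\}_{n\ge0}$ it is an $\Omega$-operated filtered algebra if it is a filtered algebra ($R_pR_q\subseteq R_{p+q}$) and $P_\omega(R_n)\subseteq R_{n+1}$. Homomorphisms of $\Omega$-operated filtered algebras are algebra homomorphisms commuting with the operators and preserving the filtrations. Forests: $\mathcal{F}(X,\Omega)$ is the set of planar rooted forests (noncommutative concatenations of planar rooted trees, with $1$ the empty forest) with vertices decorated by $X\sqcup\Omega$ such that internal (non-leaf) vertices are decorated by $\Omega$ only (leaves may be decorated by $X$ or $\Omega$; the vertex of a one-vertex tree counts as a leaf). $\mathbf{k}\mathcal{F}(X,\Omega)$ has the concatenation product and the grafting operators $B_\omega^+$ (graft a forest on a new root decorated by $\omega$, $B_\omega^+(1)=\bullet_\omega$). $\mathcal{F}_{(n)}$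 is the set of forests in $\mathcal{F}(X,\Omega)$ with at most $n$ vertices, and $\mathbf{k}\mathcal{F}(X,\Omega)$ is filtered by $\mathbf{k}\mathcal{F}_{(n)}$. Bracketed words: for a set $Y$ and $\omega\in\Omega$, $\lfloor Y\rfloor_\omega=\{\lfloor y\rfloor_\omega\mid y\in Y\}$ is a copy of $Y$, disjoint from $Y$ and from the copies for other $\omega$. With $M(\cdot)$ (resp. $S(\cdot)$) the free monoid (resp. free semigroup), $\mathfrak{M}_0:=M(X)$, $\mathfrak{M}_{n+1}:=M\big(X\sqcup\bigsqcup_\omega\lfloor\mathfrak{M}_n\rfloor_\omega\big)$, $\mathfrak{M}(X,\Omega):=\bigcup_n\mathfrak{M}_n$; $\mathbf{k}\mathfrak{M}(X,\Omega)$ has concatenation product and operators $P_\omega(u)=\lfloor u\rfloor_\omega$. $\theta:\mathbf{k}\mathfrak{M}(X,\Omega)\to\mathbf{k}\mathcal{F}(X,\Omega)$ is the isomorphism of $\Omega$-operated algebras with $\theta(x)=\bullet_x$ (so $\theta(\lfloor w\rfloor_\omega)=B_\omega^+(\theta(w))$). With $U^r$ the $r$-fold product set ($U^0=\{1\}$) and $\lfloor U\rfloor_\Omega=\{\lfloor u\rfloor_\omega\mid u\in U,\omega\in\Omega\}$, let $$\Lambda(Y,Z):=\Big(\bigcup_{r\ge1}(Y\lfloor Z\rfloor_\Omega)^r\Big)\cup\Big(\bigcup_{r\ge0}(Y\lfloor Z\rfloor_\Omega)^rY\Big)\cup\Big(\bigcup_{r\ge1}(\lfloor Z\rfloor_\Omega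 Y)^r\Big)\cup\Big(\bigcup_{r\ge0}(\lfloor Z\rfloor_\Omega Y)^r\lfloor Z\rfloor_\Omega\Big)\cup\{1\},$$ $\mathfrak{X}_0:=M(X)$, $\mathfrak{X}_n:=\Lambda(S(X),\mathfrak{X}_{n-1})$, $\mathfrak{X}_\infty:=\bigcup_n\mathfrak{X}_n$ (the bracketed words with no subword $\lfloor u\rfloor_\alpha\lfloor v\rfloor_\beta$). Let $\mathrm{Id}(S)$ be the operated ideal of $\mathbf{k}\mathfrak{M}(X,\Omega)$ (smallest ideal closed under all $P_\omega$) generated by $S=\{\lfloor x\rfloor_\alpha\lfloor y\rfloor_\beta-\lfloor x\lfloor y\rfloor_\beta\rfloor_\alpha-\lfloor\lfloor x\rfloor_\alpha y\rfloor_\beta-\lambda_\beta\lfloor xy\rfloor_\alpha\mid x,y\in\mathfrak{M}(X,\Omega),\alpha,\beta\in\Omega\}$. One has $\mathbf{k}\mathfrak{M}(X,\Omega)=\mathrm{Id}(S)\oplus\mathbf{k}\mathfrak{X}_\infty$; $\varphi:\mathbf{k}\mathfrak{M}(X,\Omega)\to\mathbf{k}\mathfrak{X}_\infty$ is the projection, and $\mathbf{k}\mathfrak{X}_\infty$ carries the product of the quotient, $w\diamond_{\mathfrak{w}}w'=\varphi(ww')$. Transport to forests: $\mathfrak{L}_\infty:=\theta(\mathfrak{X}_\infty)$ (matching Rota-Baxter forests), $\mathrm{Sha}^{NC}_{RT}(X,\Omega):=\mathbf{k}\mathfrak{L}_\infty$, $F\diamond_\ell F':=\theta(\theta^{-1}(F)\diamond_{\mathfrak{w}}\theta^{-1}(F'))$,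 operators $B_\omega^+$ (restricted), $\psi:=\theta\varphi\theta^{-1}:\mathbf{k}\mathcal{F}(X,\Omega)\to\mathrm{Sha}^{NC}_{RT}(X,\Omega)$, and $\mathfrak{L}_{(n)}:=\mathcal{F}_{(n)}\cap\mathfrak{L}_\infty$. *)

(* Defs.v *)
From HB Require Import structures.
From mathcomp Require Import all_boot all_algebra.
From mathcomp Require Import finmap.
From mathcomp Require Import boolp classical_sets.
From mathcomp Require Import monalg.

Set Implicit Arguments.
Unset Strict Implicit.
Unset Printing Implicit Defensive.

Import GRing.Theory.

Local Open Scope classical_set_scope.
Local Open Scope ring_scope.

Local Notation "1" := (@mone _) : monom_scope.
Local Notation "x * y" := (mmul x y) : monom_scope.

(* The operations are kept apart from their laws ([operated_algebra]) because
   associativity, bilinearity and the unit laws of the product of [Sha_alg]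
   are theorems about the formula defining it.  Unlike [algType k], this also
   allows the zero algebra. *)
Record opData (k : comNzRingType) (W : Type) := OpData {
  op_sort :> lmodType k;
  op_mul : op_sort -> op_sort -> op_sort;
  op_one : op_sort;
  op_P : W -> op_sort -> op_sort }.

Section OperatedAlgebras.
Context {k : comNzRingType} {W : Type}.
Implicit Types A B : opData k W.

Record operated_algebra A : Prop := OperatedAlgebra {
  oa_mulA : associative (@op_mul _ _ A);
  oa_mul1l : left_id (op_one A) (@op_mul _ _ A);
  oa_mul1r : right_id (op_one A) (@op_mul _ _ A);
  oa_linearl : forall y : A, linear (fun x : A => op_mul x y);
  oa_linearr : forall x : A, linear (fun y : A => op_mul x y);
  oa_linearP : forall w : W, linear (@op_P _ _ A w) }.

Definition operated_hom A B (f : A -> B) : Prop :=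
  [/\ linear f,
      forall x y : A, f (op_mul x y) = op_mul (f x) (f y),
      f (op_one A) = op_one B
    & forall (w : W) (x : A), f (op_P w x) = op_P w (f x)].

Definition matching_RB_algebra (lam : W -> k) A : Prop :=
  operated_algebra A /\
  forall (a b : W) (x y : A),
    op_mul (op_P a x) (op_P b y) =
      op_P a (op_mul x (op_P b y)) + op_P b (op_mul (op_P a x) y)
      + lam b *: op_P a (op_mul x y).

Definition free_matching_RB_algebra (lam : W -> k) (X : Type) A (j : X -> A) :
    Prop :=
  matching_RB_algebra lam A /\
  forall B, matching_RB_algebra lam B -> forall f : X -> B,
    exists! g : A -> B, operated_hom g /\ (forall x : X, g (j x) = f x).

(* Increasing exhaustive filtrations by submodules, with 1 in degree 0. *)
Record operated_filtered_algebra A (Fil : nat -> set A) : Prop :=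
  OperatedFilteredAlgebra {
    ofa_algebra : operated_algebra A;
    ofa_zero : forall n, Fil n 0;
    ofa_linear : forall n (c : k) (x y : A),
      Fil n x -> Fil n y -> Fil n (c *: x + y);
    ofa_incr : forall n, Fil n `<=` Fil n.+1;
    ofa_exhaust : \bigcup_n Fil n = setT;
    ofa_one : Fil 0%N (op_one A);
    ofa_mul : forall (p q : nat) (x y : A),
      Fil p x -> Fil q y -> Fil (p + q)%N (op_mul x y);
    ofa_P : forall n (w : W) (x : A), Fil n x -> Fil n.+1 (op_P w x) }.

Definition operated_filtered_hom A (FilA : nat -> set A)
    B (FilB : nat -> set B) (f : A -> B) : Prop :=
  [/\ operated_filtered_algebra FilA, operated_filtered_algebra FilB,
      operated_hom f & forall n, f @` FilA n `<=` FilB n].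

Record operated_ideal A (I : set A) : Prop := OperatedIdeal {
  oi_zero : I 0;
  oi_linear : forall (c : k) (x y : A), I x -> I y -> I (c *: x + y);
  oi_mull : forall x y : A, I y -> I (op_mul x y);
  oi_mulr : forall x y : A, I x -> I (op_mul x y);
  oi_P : forall (w : W) (x : A), I x -> I (op_P w x) }.

Definition gen_operated_ideal A (S : set A) : set A :=
  [set u | forall I : set A, operated_ideal I -> S `<=` I -> I u].

End OperatedAlgebras.

(* kspan k D is the free module k D on a set D of basis elements, realised
   inside the free module on the whole type. *)
Section Span.
Context (k : comNzRingType) (K : choiceType).
Implicit Types (D : set K) (u : {malg k[K]}).

Definition supported_on D : {pred {malg k[K]}} :=
  fun u => `[< forall m, m \in msupp u -> D m >].

Lemma supported_onP D u :
  reflect (forall m, u@_m <> 0 -> D m) (u \in supported_on D).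
Proof.
apply: (iffP idP) => [/asboolP uD m /eqP|uD].
  by rewrite mcoeff_neq0; apply: uD.
by apply/asboolP => m; rewrite -mcoeff_neq0 => /eqP; apply: uD.
Qed.

Lemma supported_on_submod D : subsemimod_closed (supported_on D).
Proof.
split; [split|] => [|u v /supported_onP uD /supported_onP vD|c u /supported_onP uD].
- by apply/supported_onP => m; rewrite mcoeff0.
- apply/supported_onP => m; rewrite mcoeffD => uvm.
  case: (eqVneq u@_m 0) => [um|/eqP]; last exact: uD.
  by apply: vD => vm; apply: uvm; rewrite um vm addr0.
- apply/supported_onP => m; rewrite mcoeffZ => cum.
  by apply: uD => um; apply: cum; rewrite um mulr0.
Qed.

Record kspan D : Type := KSpan { kspan_val : {malg k[K]};
                                 _ : kspan_val \in supported_on D }.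

HB.instance Definition _ D := [isSub for @kspan_val D].
HB.instance Definition _ D := [Choice of kspan D by <:].
HB.instance Definition _ D :=
  GRing.SubChoice_isSubLmodule.Build k {malg k[K]} (supported_on D) (kspan D)
    (supported_on_submod D).

Lemma kspanP D (u : kspan D) : val u \in supported_on D.
Proof. exact: valP. Qed.

Lemma supported_onU D c m : D m -> << c *g m >> \in supported_on D.
Proof.
move=> Dm; apply/supported_onP => m'; rewrite mcoeffU.
by case: eqP => [<-|].
Qed.

Definition kbasis D m (Dm : D m) : kspan D := KSpan (supported_onU 1 Dm).

End Span.

Section LinearExtension.
Context (k : comNzRingType) (K K' : choiceType).

Definition malg_map (h : K -> K') (u : {malg k[K]}) : {malg k[K']} :=
  \sum_(m <- msupp u) << u@_m *g h m >>.

Context (D : set K) (D' : set K') (h : K -> K').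
Hypothesis hD : forall m, D m -> D' (h m).

Lemma malg_map_supported (u : kspan k D) :
  malg_map h (val u) \in supported_on D'.
Proof.
apply/supported_onP => m'; rewrite /malg_map raddf_sum /= => um'.
apply: contrapT => Dm'; apply: um'.
rewrite big_seq big1 // => m; rewrite -mcoeff_neq0 => /eqP um.
rewrite mcoeffU; case: eqP => // hm.
by case: Dm'; rewrite -hm; apply: hD; apply: (supported_onP _ _ (kspanP u)).
Qed.

Definition kspan_map (u : kspan k D) : kspan k D' :=
  KSpan (malg_map_supported u).

End LinearExtension.

Arguments malg_map {k K K'}.
Arguments kspan_map {k K K' D D' h}.

Section BracketedWords.
Context (X W : Type).

(* A letter is an x in X or a bracket of a word.  As terms have finite depth,
   the words over [letter] are the union of the stages M_n. *)
Inductive letter : Type :=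
  | Var of X
  | Bracket of W & seq letter.

HB.instance Definition _ := gen_eqMixin letter.
HB.instance Definition _ := gen_choiceMixin letter.

Definition word := {fmonom letter}.

Definition bracket (w : W) (u : word) : word := fmu (Bracket w u).

Definition set_mul (U V : set word) : set word :=
  [set (u * v)%M | u in U & v in V].

Fixpoint set_exp (U : set word) (r : nat) : set word :=
  if r is r'.+1 then set_mul U (set_exp U r') else [set 1%M].

Definition set_bracket (U : set word) : set word :=
  [set bracket w u | w in setT & u in U].

Definition Lambda (Y Z : set word) : set word :=
  (\bigcup_(r in [set r | (1 <= r)%N]) set_exp (set_mul Y (set_bracket Z)) r)
  `|` (\bigcup_r set_mul (set_exp (set_mul Y (set_bracket Z)) r) Y)
  `|` (\bigcup_(r in [set r | (1 <= r)%N]) set_exp (set_mul (set_bracket Z) Y) r)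
  `|` (\bigcup_r set_mul (set_exp (set_mul (set_bracket Z) Y) r) (set_bracket Z))
  `|` [set 1%M].

Definition free_monoid_X : set word := [set FMonom (map Var s) | s in setT].
Definition free_semigroup_X : set word :=
  [set FMonom (map Var s) | s in [set s | s <> [::]]].

Fixpoint frakX (n : nat) : set word :=
  if n is n'.+1 then Lambda free_semigroup_X (frakX n') else free_monoid_X.

Definition frakX_oo : set word := \bigcup_n frakX n.

Lemma frakX_oo_one : frakX_oo 1%M.
Proof. by exists 1%N => //; right. Qed.

Lemma frakX_oo_var x : frakX_oo (fmu (Var x)).
Proof. by exists 0%N => //; exists [:: x] => //; rewrite fmuE. Qed.

Lemma frakX_oo_bracket w u : frakX_oo u -> frakX_oo (bracket w u).
Proof.
move=> [n _ un]; exists n.+1 => //; left; right; exists 0%N => //.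
exists 1%M => //; exists (bracket w u); last exact: mul1m.
by exists w => //; exists u.
Qed.

End BracketedWords.

Section Forests.
Context (X W : Type).

(* Planar rooted trees decorated by X and W whose internal vertices are
   decorated by W: [Node w [::]] is the leaf decorated by w. *)
Inductive tree : Type :=
  | Leaf of X
  | Node of W & seq tree.

HB.instance Definition _ := gen_eqMixin tree.
HB.instance Definition _ := gen_choiceMixin tree.

Definition forest := {fmonom tree}.

Definition graft (w : W) (F : forest) : forest := fmu (Node w F).

Fixpoint tree_vertices (t : tree) : nat :=
  if t is Node _ s then (sumn (map tree_vertices s)).+1 else 1%N.

Definition vertices (F : forest) : nat := sumn (map tree_vertices F).

Definition forests_le (n : nat) : set forest :=
  [set F | (vertices F <= n)%N].

Fixpoint tree_of_letter (l : letter X W) : tree :=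
  match l with
  | Var x => Leaf x
  | Bracket w s => Node w (map tree_of_letter s)
  end.

Fixpoint letter_of_tree (t : tree) : letter X W :=
  match t with
  | Leaf x => Var W x
  | Node w s => Bracket w (map letter_of_tree s)
  end.

Definition forest_of_word (u : word X W) : forest :=
  FMonom (map tree_of_letter u).

Definition word_of_forest (F : forest) : word X W :=
  FMonom (map letter_of_tree F).

Lemma tree_of_letterK : cancel tree_of_letter letter_of_tree.
Proof.
rewrite /cancel; fix IH 1; case=> [x|w s] /=; first exact: erefl.
congr Bracket.
by elim: s => [//|l s IHs] /=; rewrite IH IHs.
Qed.

Lemma letter_of_treeK : cancel letter_of_tree tree_of_letter.
Proof.
rewrite /cancel; fix IH 1; case=> [x|w s] /=; first exact: erefl.
congr Node.
by elim: s => [//|l s IHs] /=; rewrite IH IHs.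
Qed.

Lemma forest_of_wordK : cancel forest_of_word word_of_forest.
Proof.
by move=> u; rewrite /word_of_forest /= (mapK tree_of_letterK) fmK.
Qed.

Lemma word_of_forestK : cancel word_of_forest forest_of_word.
Proof.
by move=> F; rewrite /forest_of_word /= (mapK letter_of_treeK) fmK.
Qed.

Definition frakL_oo : set forest := forest_of_word @` @frakX_oo X W.

Definition frakL_le (n : nat) : set forest := forests_le n `&` frakL_oo.

Lemma frakL_oo_of_word u : frakX_oo u -> frakL_oo (forest_of_word u).
Proof. by exists u. Qed.

Lemma word_of_frakL_oo F : frakL_oo F -> frakX_oo (word_of_forest F).
Proof. by move=> [u uX <-]; rewrite forest_of_wordK. Qed.

Lemma frakL_oo_one : frakL_oo 1%M.
Proof.
exists 1%M; first exact: frakX_oo_one.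
by apply/val_inj; rewrite /= !fm1.
Qed.

Lemma frakL_oo_leaf x : frakL_oo (fmu (Leaf x)).
Proof.
exists (fmu (Var W x)); first exact: frakX_oo_var.
by apply/val_inj; rewrite /= !fmU.
Qed.

Lemma frakL_oo_graft w F : frakL_oo F -> frakL_oo (graft w F).
Proof.
move=> [u uX <-]; exists (bracket w u); first exact: frakX_oo_bracket.
by apply/val_inj; rewrite /= !fmU.
Qed.

End Forests.

Section MatchingRotaBaxterForests.
Context (k : comNzRingType) (X W : Type) (lam : W -> k).

Local Notation kM := {malg k[word X W]}.
Local Notation kF := {malg k[forest X W]}.
Local Notation kX := (kspan k (@frakX_oo X W)).
Local Notation Sha := (kspan k (@frakL_oo X W)).

Definition kM_alg : opData k W :=
  @OpData k W kM *%R 1 (fun w => malg_map (bracket w)).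

Definition kF_alg : opData k W :=
  @OpData k W kF *%R 1 (fun w => malg_map (graft w)).

Definition RB_relations : set kM :=
  [set u | exists (x y : word X W) (a b : W),
     u = << (bracket a x * bracket b y)%M >>
       - << bracket a (x * bracket b y)%M >>
       - << bracket b (bracket a x * y)%M >>
       - lam b *: << bracket a (x * y)%M >>].

Definition IdS : set kM := gen_operated_ideal (RB_relations : set kM_alg).

(* The projection onto kX along IdS: phi u is the element v of kX with
   u - v in IdS, which exists and is unique because kM is the direct sum of
   IdS and kX. *)
Definition phi (u : kM) : kX := xget 0 [set v : kX | IdS (u - val v)].

Definition diamond_w (u v : kX) : kX := phi (val u * val v).

Definition theta_inv : kF -> kM := malg_map (@word_of_forest X W).

Definition theta_oo : kX -> Sha := kspan_map (@frakL_oo_of_word X W).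

Definition theta_oo_inv : Sha -> kX := kspan_map (@word_of_frakL_oo X W).

Definition diamond_l (u v : Sha) : Sha :=
  theta_oo (diamond_w (theta_oo_inv u) (theta_oo_inv v)).

Definition Sha_alg : opData k W :=
  @OpData k W Sha diamond_l (kbasis k (frakL_oo_one X W))
    (fun w => kspan_map (@frakL_oo_graft X W w)).

Definition jX (x : X) : Sha_alg := kbasis k (frakL_oo_leaf W x).

Definition psi (u : kF_alg) : Sha_alg := theta_oo (phi (theta_inv u)).

Definition kF_filtration (n : nat) : set kF_alg :=
  [set u : kF | u \in supported_on (@forests_le X W n)].

Definition Sha_filtration (n : nat) : set Sha_alg :=
  [set u : Sha | val u \in supported_on (@frakL_le X W n)].

Lemma jX_inj : injective jX.
Proof.
move=> x y /(congr1 val) /= /(congr1 (mcoeff (fmu (Leaf W x)))).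
rewrite mcoeffUU mcoeffU; case: eqP => [|_ /eqP]; last by rewrite oner_eq0.
by move=> /(congr1 val); rewrite /= !fmU => -[].
Qed.

End MatchingRotaBaxterForests.

Arguments Sha_alg {k} X {W} lam.
Arguments jX {k X W} lam x.
Arguments psi {k X W} lam u.
Arguments kF_alg k X W : clear implicits.
Arguments kF_filtration k X W n : clear implicits.
Arguments Sha_filtration {k} X {W} lam n.

(* Main.v *)
Require Import Defs.
From mathcomp Require Import all_boot all_algebra.
From mathcomp Require Import finmap boolp classical_sets monalg.
From mathcomp Require Import zify ssrAC.

(** Why the theorem holds.

    Read the matching Rota-Baxter identity as a rewriting rule on bracketed
    words, which replaces a product of two brackets by

      [u]_a [v]_b  ->  [u [v]_b]_a + [[u]_a v]_b + lam_b [u v]_a.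

    No term on the right has more vertices, and every one has one letter less
    at the place of rewriting, so rewriting terminates ([rank]). The normal
    form [nf] follows one strategy, leftmost outermost. The essential point is
    that it does not depend on the strategy ([nf_step]): two redexes interfere
    only inside a product [u]_a [v]_b [w]_c of three brackets, and there the
    two ways of rewriting give the same eleven terms ([lin3_overlap]). This is
    where the exact form of the identity, with weight lam_b for P_a P_b, is
    used.

    Extended linearly, [nf_lin] therefore vanishes on the operated ideal
    generated by the relations ([nf_lin_IdS]). It takes its values in the span
    of the words without adjacent brackets ([nf_lin_supported]), fixes these
    words ([nf_lin_id]), and differs from the identity by elements of the ideal
    ([IdS_nf_lin]). Since the words without adjacent brackets are those of the
    alternating products ([frakX_ooE]), this is the decomposition of the free
    operated algebra as the ideal plus its complement, and the projection is
    [nf_lin] ([phiE]).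

    Everything else is formal. Up to the bijection between words and forests,
    the projection is a surjective homomorphism [to_Sha] of operated algebras
    whose kernel is the ideal. So the forests form the quotient of the free
    operated algebra by the matching Rota-Baxter relations: they inherit the
    algebra laws and the identity ([Sha_matching_RB]), and evaluation of words
    in any matching Rota-Baxter algebra factors through them, in a unique way
    as words are generated by letters ([Sha_free]). Since rewriting does not
    increase the number of vertices ([nf_bounded]), the projection and hence
    the product respect the filtrations ([Sha_operated_filtered],
    [psi_filtered_hom]). *)

Set Implicit Arguments.
Unset Strict Implicit.
Unset Printing Implicit Defensive.

Import GRing.Theory.

Local Open Scope classical_set_scope.
Local Open Scope ring_scope.

Local Notation "1" := (@mone _) : monom_scope.
Local Notation "x * y" := (mmul x y) : monom_scope.

(** * Linear maps on free modules *)

(** The operations of an operated algebra are bare functions with a proof of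
    linearity; these are the consequences of such a proof. *)
Section RawLinear.
Context (k : comNzRingType) (U V : lmodType k) (f : U -> V).
Context (f_lin : linear f).

Lemma raw_linear0 : f 0 = 0.
Proof. by have := f_lin (-1) 0 0; rewrite scaler0 addr0 scaleN1r addNr. Qed.

Lemma raw_linearZ c u : f (c *: u) = c *: f u.
Proof. by have := f_lin c u 0; rewrite !addr0 raw_linear0 addr0. Qed.

Lemma raw_linearD u v : f (u + v) = f u + f v.
Proof. by have := f_lin 1 u v; rewrite !scale1r. Qed.

Lemma raw_linearB u v : f (u - v) = f u - f v.
Proof. by rewrite addrC -scaleN1r f_lin scaleN1r addrC. Qed.

(** The shape of the matching Rota-Baxter relations. *)
Lemma raw_linear_relation c u v w t :
  f (u - v - w - c *: t) = f u - f v - f w - c *: f t.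
Proof. by rewrite !raw_linearB raw_linearZ. Qed.

End RawLinear.

Lemma raw_linear_comp (k : comNzRingType) (U V T : lmodType k)
    (f : U -> V) (g : V -> T) :
  linear f -> linear g -> linear (fun u => g (f u)).
Proof. by move=> fl gl c u v; rewrite fl gl. Qed.

Section Supports.
Context (k : comNzRingType) (K : choiceType).
Implicit Types (D E : set K) (u v : {malg k[K]}).

Lemma supported0 D : (0 : {malg k[K]}) \in supported_on D.
Proof. by have [[]] := supported_on_submod k D. Qed.

Lemma supported_lin D (c : k) u v :
  u \in supported_on D -> v \in supported_on D -> c *: u + v \in supported_on D.
Proof. by have [[_ DD] DZ] := supported_on_submod k D => /(DZ c); exact: DD. Qed.

Lemma supported_sub D E u :
  D `<=` E -> u \in supported_on D -> u \in supported_on E.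
Proof. by move=> DE /supported_onP uD; apply/supported_onP => m /uD /DE. Qed.

Lemma supportedT u : u \in supported_on setT.
Proof. exact/supported_onP. Qed.

(** The submodule spanned by [D] is the least one containing [D]; most
    statements below about linear combinations reduce to basis elements by this
    induction. *)
Lemma supported_ind D (Q : {malg k[K]} -> Prop) :
  Q 0 -> (forall c u v, Q u -> Q v -> Q (c *: u + v)) ->
  (forall m, D m -> Q << m >>) ->
  forall u, u \in supported_on D -> Q u.
Proof.
move=> Q0 Ql QD u /supported_onP uD; rewrite [u]monalgE big_seq.
apply: big_ind => // [v w Qv Qw|m]; first by rewrite -[v]scale1r; apply: Ql.
rewrite -mcoeff_neq0 => /eqP um.
have -> : << u@_m *g m >> = u@_m *: << m >> + 0.
  by rewrite addr0; apply/malgP => j; rewrite mcoeffZ !mcoeffU mulrnAr mulr1.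
by apply: Ql => //; apply/QD/uD.
Qed.

Lemma malg_ind (Q : {malg k[K]} -> Prop) :
  Q 0 -> (forall c u v, Q u -> Q v -> Q (c *: u + v)) ->
  (forall m, Q << m >>) -> forall u, Q u.
Proof. by move=> Q0 Ql QU u; apply: (supported_ind (D := setT)) (supportedT u). Qed.

End Supports.

Section LinearExtensions.
Context (k : comNzRingType) (K : choiceType) (V : lmodType k).

Definition lin_ext (h : K -> V) (u : {malg k[K]}) : V :=
  \sum_(m <- msupp u) u@_m *: h m.

(** Any finite set containing the support computes the same sum; this gives a
    common index set for two elements and their linear combinations. *)
Lemma lin_extEw h (d : {fset K}) u : (msupp u `<=` d)%fset ->
  lin_ext h u = \sum_(m <- d) u@_m *: h m.
Proof.
move=> le; rewrite /lin_ext (big_fset_incl _ le) // => m _ /mcoeff_outdom ->.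
by rewrite scale0r.
Qed.

Lemma lin_ext_linear h : linear (lin_ext h).
Proof.
move=> c u v; set d := (msupp (c *: u + v) `|` (msupp u `|` msupp v))%fset.
rewrite !(@lin_extEw h d); first last.
- by rewrite fsubsetUl.
- by rewrite fsubsetU // fsubsetUl orbT.
- by rewrite fsubsetU // fsubsetUr orbT.
rewrite scaler_sumr -big_split; apply: eq_bigr => m _ /=.
by rewrite mcoeffD mcoeffZ scalerDl scalerA.
Qed.

Lemma lin_extU h m : lin_ext h << m >> = h m.
Proof.
by rewrite (@lin_extEw h [fset m]%fset) ?msuppU_le // big_seq_fset1 mcoeffUU scale1r.
Qed.

Lemma eq_linear_malg (f g : {malg k[K]} -> V) : linear f -> linear g ->
  (forall m, f << m >> = g << m >>) -> f =1 g.
Proof.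
move=> fl gl fg; apply: malg_ind => [|c u v e1 e2|//].
  by rewrite !raw_linear0.
by rewrite fl gl e1 e2.
Qed.

End LinearExtensions.

Section MalgMap.
Context (k : comNzRingType) (K K' : choiceType) (h : K -> K').

Lemma malg_mapE (u : {malg k[K]}) :
  malg_map h u = lin_ext (fun m => << h m >>) u.
Proof.
apply: eq_bigr => m _; apply/malgP => j.
by rewrite mcoeffZ !mcoeffU mulrnAr mulr1.
Qed.

Lemma malg_map_linear : linear (malg_map h : {malg k[K]} -> {malg k[K']}).
Proof. by move=> c u v; rewrite !malg_mapE lin_ext_linear. Qed.

Lemma malg_mapU m : malg_map h << m >> = << h m >> :> {malg k[K']}.
Proof. by rewrite malg_mapE lin_extU. Qed.

Lemma supported_malg_map (D : set K) (D' : set K') (u : {malg k[K]}) :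
  (forall m, D m -> D' (h m)) ->
  u \in supported_on D -> malg_map h u \in supported_on D'.
Proof.
move=> hD; move: u; apply: supported_ind => [|c u v uD vD|m Dm].
- by rewrite (raw_linear0 malg_map_linear) supported0.
- by rewrite malg_map_linear; exact: supported_lin.
- by rewrite malg_mapU supported_onU //; apply: hD.
Qed.

End MalgMap.

Lemma malg_map_cancel (k : comNzRingType) (K K' : choiceType) (h : K -> K')
    (h' : K' -> K) (u : {malg k[K]}) :
  cancel h h' -> malg_map h' (malg_map h u) = u.
Proof.
move=> hK; move: u; apply: eq_linear_malg => [c u v|//|m].
  by rewrite !malg_map_linear.
by rewrite !malg_mapU hK.
Qed.

Section MonoidAlgebra.
Context (k : comNzRingType) (K : monomType).
Implicit Types u v w : {malg k[K]}.

Lemma malgUM (m n : K) : << m >> * << n >> = << (m * n)%M >> :> {malg k[K]}.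
Proof. by rewrite malgM_def fgmulUU mulr1. Qed.

Lemma malg_scalerAr c u v : u * (c *: v) = c *: (u * v).
Proof.
move: u; apply: malg_ind => [|a u u' IHu IHu'|m].
- by rewrite !mul0r scaler0.
- by rewrite !mulrDl -!scalerAl IHu IHu' scalerDr !scalerA [a * c]mulrC.
move: v c; apply: malg_ind => [|a v v' IHv IHv'|n] c.
- by rewrite scaler0 mulr0 scaler0.
- by rewrite scalerDr scalerA !mulrDr IHv IHv' IHv scalerDr scalerA.
have -> : c *: << n >> = << c *g n >> :> {malg k[K]}.
  by apply/malgP => j; rewrite mcoeffZ !mcoeffU mulrnAr mulr1.
rewrite malgUM malgM_def fgmulUU mul1r.
by apply/malgP => j; rewrite mcoeffZ !mcoeffU mulrnAr mulr1.
Qed.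

Lemma malg_mulr_linear u : linear (fun v => u * v).
Proof. by move=> c v v'; rewrite mulrDr malg_scalerAr. Qed.

Lemma malg_mull_linear v : linear (fun u => u * v).
Proof. by move=> c u u'; rewrite mulrDl scalerAl. Qed.

Lemma supportedM (D E F : set K) u v :
  (forall m n, D m -> E n -> F (m * n)%M) ->
  u \in supported_on D -> v \in supported_on E -> u * v \in supported_on F.
Proof.
move=> DEF uD vE; move: u uD; apply: supported_ind => [|c u u' uF u'F|m Dm].
- by rewrite mul0r supported0.
- by rewrite malg_mull_linear; exact: supported_lin.
move: v vE; apply: supported_ind => [|c v v' vF v'F|n En].
- by rewrite mulr0 supported0.
- by rewrite malg_mulr_linear; exact: supported_lin.
- by rewrite malgUM supported_onU //; apply: DEF.
Qed.

End MonoidAlgebra.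

(** * Rewriting bracketed words to normal form *)

Section ThreeTermSums.
Context (k : comNzRingType) (V : lmodType k).

Lemma lin3_add (x1 x2 x3 y1 y2 y3 z1 z2 z3 : V) (c d : k) :
  (x1 + x2 + c *: x3) + (y1 + y2 + c *: y3) + d *: (z1 + z2 + c *: z3) =
  (x1 + y1 + d *: z1) + (x2 + y2 + d *: z2) + c *: (x3 + y3 + d *: z3).
Proof.
rewrite !scalerDr !scalerA (mulrC d c).
by rewrite [LHS](AC (3*3*3) ((1*4*7)*(2*5*8)*(3*6*9))).
Qed.

(** The overlap of two redexes: the left side lists the terms obtained from a
    product of three brackets by rewriting its first two brackets first, the
    right side those obtained by rewriting its last two brackets first. *)
Lemma lin3_overlap (x1 x2 x3 x4 x5 y1 y2 y3 z1 z2 z3 : V) (c d : k) :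
  ((x1 + x2 + c *: x3) + x4 + c *: x5) + (y1 + y2 + c *: y3)
    + d *: (z1 + z2 + c *: z3) =
  (x1 + y1 + d *: z1) + (x2 + (x4 + y2 + d *: z2) + c *: x5)
    + c *: (x3 + y3 + d *: z3).
Proof.
rewrite !scalerDr !scalerA (mulrC d c).
by rewrite [LHS](AC (5*3*3) ((1*6*9)*(2*(4*7*10)*5)*(3*8*11))).
Qed.

Lemma lin3_sub (x y z : V) : x + y + z - x - y - z = 0.
Proof.
have -> : x + y + z - x - y - z = (x - x) + (y - y) + (z - z).
  by rewrite [LHS](AC (3*1*1*1) ((1*4)*(2*5)*(3*6))).
by rewrite !subrr !addr0.
Qed.

Lemma lin3_telescope (w x1 x2 x3 y1 y2 y3 : V) (c : k) :
  (w - x1 - x2 - c *: x3) + ((x1 - y1) + (x2 - y2) + c *: (x3 - y3)) =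
  w - (y1 + y2 + c *: y3).
Proof.
rewrite scalerBr !opprD; set z := c *: x3.
have -> : w - x1 - x2 - z + (x1 - y1 + (x2 - y2) + (z - c *: y3)) =
    w + (x1 - x1) + (x2 - x2) + (z - z) + (- y1 - y2 - c *: y3).
  by rewrite [LHS](AC (4*((2*2)*2)) (1*(5*2)*(7*3)*(9*4)*(6*8*10))).
by rewrite !subrr !addr0.
Qed.

End ThreeTermSums.

Section NormalForm.
Context (k : comNzRingType) (X W : Type) (lam : W -> k).

Local Notation letter := (letter X W).
Local Notation kM := {malg k[word X W]}.
Local Notation P a := (malg_map (bracket (X := X) a) : kM -> kM).

Implicit Types (s t u v : seq letter) (a b : W).

Lemma fm_mul s t : (FMonom s * FMonom t)%M = FMonom (s ++ t) :> word X W.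
Proof. by apply: val_inj; exact: fmM. Qed.

Lemma fm_one : 1%M = FMonom [::] :> word X W.
Proof. by apply: val_inj; rewrite /= fm1. Qed.

Lemma fm_bracket a s : bracket a (FMonom s) = FMonom [:: Bracket a s].
Proof. by apply: val_inj; exact: fmU. Qed.

Definition kword s : kM := << FMonom s >>.

Lemma kwordM s t : kword s * kword t = kword (s ++ t).
Proof. by rewrite /kword malgUM fm_mul. Qed.

Lemma kword_cons l s : kword (l :: s) = kword [:: l] * kword s.
Proof. by rewrite kwordM. Qed.

Lemma kword0 : kword [::] = 1.
Proof. by rewrite /kword -fm_one. Qed.

Lemma P_kword a s : P a (kword s) = kword [:: Bracket a s].
Proof. by rewrite /kword malg_mapU fm_bracket. Qed.

Lemma kword_ind (Q : kM -> Prop) :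
  Q 0 -> (forall c (p q : kM), Q p -> Q q -> Q (c *: p + q)) ->
  (forall s, Q (kword s)) -> forall p, Q p.
Proof. by move=> Q0 Ql QU; apply: malg_ind => // -[s]; apply: QU. Qed.

Lemma eq_linear_kword (V : lmodType k) (f g : kM -> V) : linear f -> linear g ->
  (forall s, f (kword s) = g (kword s)) -> f =1 g.
Proof. by move=> fl gl fg; apply: eq_linear_malg fl gl _ => -[s]; exact: fg. Qed.

Definition weight s := vertices (forest_of_word (FMonom s)).

Lemma weight_nil : weight [::] = 0%N.
Proof. by []. Qed.

Lemma weight_var x s : weight (Var W x :: s) = (weight s).+1.
Proof. by []. Qed.

Lemma weight_bracket a u s :
  weight (Bracket a u :: s) = (weight u + weight s).+1.
Proof. by []. Qed.

Lemma weight_cat s t : weight (s ++ t) = (weight s + weight t)%N.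
Proof. by rewrite /weight /vertices /= !map_cat sumn_cat. Qed.

Definition weightE := (weight_cat, weight_bracket, weight_var, weight_nil).

Lemma size_weight s : (size s <= weight s)%N.
Proof.
elim: s => // -[x|a u] s IHs; rewrite !weightE //.
by rewrite ltnS (leq_trans IHs) // leq_addl.
Qed.

(** A measure for the recursion computing normal forms. Rewriting the head redex
    does not increase the number of vertices and merges two letters into one.
    Passing from a bracket to its contents loses a vertex but may gain letters,
    at most as many as there are vertices: the square outweighs them. *)
Definition rank s := (weight s * weight s + size s)%N.

Lemma rank_weight s t : (weight s < weight t)%N -> (rank s < rank t)%N.
Proof.
rewrite /rank => st; have := size_weight s.
move: (weight s) (weight t) (size s) (size t) st => m n p q; nia.
Qed.

Lemma rank_size s t :
  (weight s <= weight t)%N -> (size s < size t)%N -> (rank s < rank t)%N.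
Proof.
rewrite /rank; move: (weight s) (weight t) (size s) (size t) => m n p q; nia.
Qed.

Lemma rank_tail l s : (rank s < rank (l :: s))%N.
Proof.
by apply: rank_size => //; case: l => [x|a u]; rewrite weightE; lia.
Qed.

Lemma rank_inside a u s : (rank u < rank (Bracket a u :: s))%N.
Proof. by apply: rank_weight; rewrite weightE; lia. Qed.

Lemma rank_merge1 a u b v s :
  (rank (Bracket a (u ++ [:: Bracket b v]) :: s)
   < rank (Bracket a u :: Bracket b v :: s))%N.
Proof. by apply: rank_size => //; rewrite !weightE; lia. Qed.

Lemma rank_merge2 a u b v s :
  (rank (Bracket b (Bracket a u :: v) :: s)
   < rank (Bracket a u :: Bracket b v :: s))%N.
Proof. by apply: rank_size => //; rewrite !weightE; lia. Qed.

Lemma rank_merge3 a u b v s :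
  (rank (Bracket a (u ++ v) :: s) < rank (Bracket a u :: Bracket b v :: s))%N.
Proof. by apply: rank_size => //; rewrite !weightE; lia. Qed.

Definition is_bracket (l : letter) := if l is Bracket _ _ then true else false.

Definition starts_bracket s := if s is l :: _ then is_bracket l else false.

(** The number [n] of recursive calls is meant to exceed the rank of [s]. *)
Fixpoint nf_rec (n : nat) s : kM :=
  if n is n'.+1 then
    match s with
    | [::] => 1
    | Var x :: s' => kword [:: Var W x] * nf_rec n' s'
    | Bracket a u :: s' =>
        if s' is Bracket b v :: s'' then
          nf_rec n' (Bracket a (u ++ [:: Bracket b v]) :: s'')
          + nf_rec n' (Bracket b (Bracket a u :: v) :: s'')
          + lam b *: nf_rec n' (Bracket a (u ++ v) :: s'')
        else P a (nf_rec n' u) * nf_rec n' s'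
    end
  else 0.

Lemma nf_rec_stable n m s :
  (rank s < n)%N -> (rank s < m)%N -> nf_rec n s = nf_rec m s.
Proof.
elim: n m s => // n IHn [//|m] s sn sm.
have IH t : (rank t < rank s)%N -> nf_rec n t = nf_rec m t.
  by move=> ts; apply: IHn; apply: leq_trans ts _.
case: s IH {sn sm} => [//|[x|a u] s] IH /=.
  by rewrite IH // rank_tail.
have IHu := IH _ (rank_inside a u s); have IHs := IH _ (rank_tail (Bracket a u) s).
destruct s as [|[x|b v] s]; [by rewrite IHu IHs | by rewrite IHu IHs |].
by rewrite (IH _ (rank_merge1 _ _ _ _ _)) (IH _ (rank_merge2 _ _ _ _ _))
  (IH _ (rank_merge3 _ _ _ _ _)).
Qed.

(** The leftmost outermost normal form of a word, as a linear combination of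
    words without adjacent brackets. *)
Definition nf s : kM := nf_rec (rank s).+1 s.

(** One step of the recursion at an abstract depth, which keeps the rank from
    being computed. *)
Lemma nf_unfold s : exists n,
  nf s = nf_rec n.+1 s /\ forall t, (rank t < rank s)%N -> nf_rec n t = nf t.
Proof. by exists (rank s); split=> // t ts; apply: nf_rec_stable. Qed.

Lemma nf_nil : nf [::] = 1.
Proof. by []. Qed.

Lemma nf_var x s : nf (Var W x :: s) = kword [:: Var W x] * nf s.
Proof.
by have [n [-> nE]] := nf_unfold (Var W x :: s); rewrite /= nE // rank_tail.
Qed.

Lemma nf_bracket a u s : ~~ starts_bracket s ->
  nf (Bracket a u :: s) = P a (nf u) * nf s.
Proof.
have [n [-> nE]] := nf_unfold (Bracket a u :: s).
rewrite -(nE _ (rank_inside a u s)) -(nE _ (rank_tail (Bracket a u) s)) /=.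
by destruct s as [|[y|b v] t].
Qed.

Lemma nf_redex a u b v s :
  nf (Bracket a u :: Bracket b v :: s) =
    nf (Bracket a (u ++ [:: Bracket b v]) :: s)
    + nf (Bracket b (Bracket a u :: v) :: s)
    + lam b *: nf (Bracket a (u ++ v) :: s).
Proof.
have [n [-> nE]] := nf_unfold (Bracket a u :: Bracket b v :: s).
by rewrite -(nE _ (rank_merge1 _ _ _ _ _)) -(nE _ (rank_merge2 _ _ _ _ _))
  -(nE _ (rank_merge3 _ _ _ _ _)).
Qed.

(** The induction principle following the recursion that computes [nf]. *)
Lemma nf_ind (Q : seq letter -> Prop) :
  Q [::] -> (forall x s, Q s -> Q (Var W x :: s)) ->
  (forall a u s, ~~ starts_bracket s -> Q u -> Q s -> Q (Bracket a u :: s)) ->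
  (forall a u b v s, Q (Bracket a (u ++ [:: Bracket b v]) :: s) ->
     Q (Bracket b (Bracket a u :: v) :: s) -> Q (Bracket a (u ++ v) :: s) ->
     Q (Bracket a u :: Bracket b v :: s)) ->
  forall s, Q s.
Proof.
move=> Q0 Qx Qb Qr s; have [n] := ubnP (rank s).
elim: n s => // n IHn s sn.
have IH t : (rank t < rank s)%N -> Q t.
  by move=> ts; apply: IHn; apply: leq_trans ts _.
case: s IH {sn} => [//|[x|a u] s] IH; first by apply/Qx/IH/rank_tail.
have Qu := IH _ (rank_inside a u s); have Qs := IH _ (rank_tail (Bracket a u) s).
case: s IH Qu Qs => [|[x|b v] s] IH Qu Qs; try exact: Qb.
by apply: Qr; apply: IH; rewrite ?rank_merge1 ?rank_merge2 ?rank_merge3.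
Qed.

(** [rb_step s t1 t2 t3 c]: in some context, at any depth, [s] has a product of
    two brackets, which the matching Rota-Baxter identity turns into
    [t1 + t2 + c t3]. *)
Inductive rb_step :
    seq letter -> seq letter -> seq letter -> seq letter -> k -> Prop :=
  | rb_here a u b v s :
      rb_step (Bracket a u :: Bracket b v :: s)
        (Bracket a (u ++ [:: Bracket b v]) :: s)
        (Bracket b (Bracket a u :: v) :: s)
        (Bracket a (u ++ v) :: s) (lam b)
  | rb_cons l s t1 t2 t3 c : rb_step s t1 t2 t3 c ->
      rb_step (l :: s) (l :: t1) (l :: t2) (l :: t3) c
  | rb_in a s u t1 t2 t3 c : rb_step u t1 t2 t3 c ->
      rb_step (Bracket a u :: s) (Bracket a t1 :: s) (Bracket a t2 :: s)
        (Bracket a t3 :: s) c.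

Lemma rb_step_catl r s t1 t2 t3 c : rb_step s t1 t2 t3 c ->
  rb_step (r ++ s) (r ++ t1) (r ++ t2) (r ++ t3) c.
Proof. by move=> st; elim: r => //= l r; apply: rb_cons. Qed.

Lemma rb_step_catr r s t1 t2 t3 c : rb_step s t1 t2 t3 c ->
  rb_step (s ++ r) (t1 ++ r) (t2 ++ r) (t3 ++ r) c.
Proof.
elim=> [a u b v s'|l s' r1 r2 r3 c' _ IH|a s' u r1 r2 r3 c' st _] /=.
- exact: rb_here.
- exact: rb_cons.
- exact: rb_in.
Qed.

(** Confluence: [nf] takes the same value whichever redex is rewritten first.
    By induction on the rank, the head redex is compared with the given one. If
    they do not overlap, rewriting the one leaves the other in place, and the
    induction hypothesis applies to the three words obtained at the head. *)
Lemma nf_step s t1 t2 t3 c : rb_step s t1 t2 t3 c ->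
  nf s = nf t1 + nf t2 + c *: nf t3.
Proof.
have [n] := ubnP (rank s).
elim: n s t1 t2 t3 c => // n IHn s t1 t2 t3 c sn st.
have IH s' r1 r2 r3 d : (rank s' < rank s)%N -> rb_step s' r1 r2 r3 d ->
    nf s' = nf r1 + nf r2 + d *: nf r3.
  by move=> s's; apply: IHn; apply: leq_trans s's _.
case: s IH st {n IHn sn} => [|[x|a u] s] IH st; first by inversion st.
- have {st} [r1 [r2 [r3 [st -> -> ->]]]] : exists r1 r2 r3,
      [/\ rb_step s r1 r2 r3 c, t1 = Var W x :: r1, t2 = Var W x :: r2
        & t3 = Var W x :: r3].
    by inversion st; subst; do 3 eexists; split; eauto.
  by rewrite !nf_var (IH _ _ _ _ _ (rank_tail _ _) st) !mulrDr malg_scalerAr.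
have [sb|sb] := boolP (starts_bracket s); last first.
  inversion st as [? ? ? ? ? E|? ? r1 r2 r3 ? st'|? ? ? r1 r2 r3 ? st']; subst.
  - exact: nf_redex.
  - have [h1 h2 h3] : [/\ ~~ starts_bracket r1, ~~ starts_bracket r2
        & ~~ starts_bracket r3].
      by case: s sb {IH st} st' => [|[x|//] s] _ st'; inversion st'; subst.
    rewrite !nf_bracket // (IH _ _ _ _ _ (rank_tail _ _) st').
    by rewrite !mulrDr malg_scalerAr.
  rewrite !nf_bracket // (IH _ _ _ _ _ (rank_inside _ _ _) st').
  by rewrite !(raw_linearD (malg_map_linear _)) (raw_linearZ (malg_map_linear _))
    !mulrDl scalerAl.
case: s IH sb st => [//|[//|b v] s] IH _ st.
have IH1 := IH _ _ _ _ _ (rank_merge1 a u b v s).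
have IH2 := IH _ _ _ _ _ (rank_merge2 a u b v s).
have IH3 := IH _ _ _ _ _ (rank_merge3 a u b v s).
(* The head of the word is a redex; the step is at it, to its right or in [u]. *)
inversion st as [? ? ? ? ? E|? ? r1 r2 r3 ? st'|? ? ? r1 r2 r3 ? st']; subst.
- exact: nf_redex.
- inversion st' as [? ? e w r E|? ? q1 q2 q3 ? st''|? ? ? q1 q2 q3 ? st'']; subst.
  (* The overlap of three brackets. When the head redexes are rewritten on both
     sides, there remain those inside [u [v]_b [w]_e]_a on the left and
     inside [[u]_a [v]_b w]_e on the right. *)
  + rewrite (nf_redex a u b v) !(nf_redex _ _ _ _ r) -!catA /=.
    have h1 := rb_in a r (rb_step_catl u (rb_here b v e w [::])).
    have h2 := rb_in e r (rb_here a u b v w).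
    rewrite (IH _ _ _ _ _ _ h1); last by apply: rank_size => //; rewrite !weightE; lia.
    rewrite (IH _ _ _ _ _ _ h2); last by apply: rank_size => //; rewrite !weightE; lia.
    exact: lin3_overlap.
  + rewrite !nf_redex (IH1 _ _ _ _ (rb_cons _ st'')) (IH2 _ _ _ _ (rb_cons _ st'')).
    rewrite (IH3 _ _ _ _ (rb_cons _ st'')); exact: lin3_add.
  + rewrite !nf_redex (IH1 _ _ _ _ (rb_in a s (rb_step_catl u (rb_in b [::] st'')))).
    rewrite (IH2 _ _ _ _ (rb_in b s (rb_cons (Bracket a u) st''))).
    rewrite (IH3 _ _ _ _ (rb_in a s (rb_step_catl u st''))); exact: lin3_add.
- rewrite !nf_redex.
  rewrite (IH1 _ _ _ _ (rb_in a s (rb_step_catr [:: Bracket b v] st'))).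
  rewrite (IH2 _ _ _ _ (rb_in b s (rb_in a v st'))).
  rewrite (IH3 _ _ _ _ (rb_in a s (rb_step_catr v st'))); exact: lin3_add.
Qed.

End NormalForm.

(** * Words without adjacent brackets *)

Section IrreducibleWords.
Context (X W : Type).

Local Notation letter := (letter X W).
Local Notation word := (word X W).
Implicit Types (s t u v : seq letter) (a b : W) (l : letter).

Fixpoint ends_bracket s :=
  if s is l :: s' then if s' is [::] then is_bracket l else ends_bracket s'
  else false.

Fixpoint no_adjacent_brackets s :=
  if s is l :: s' then
    ~~ (is_bracket l && starts_bracket s') && no_adjacent_brackets s'
  else true.

Fixpoint irr_letter l :=
  if l is Bracket _ s then all irr_letter s && no_adjacent_brackets s else true.

Definition irr s := all irr_letter s && no_adjacent_brackets s.

Lemma irr_cons l s :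
  irr (l :: s) = [&& irr_letter l, irr s & ~~ (is_bracket l && starts_bracket s)].
Proof. by rewrite /irr /= -!andbA [_ && (no_adjacent_brackets s)]andbC. Qed.

Lemma irr_bracket a u : irr [:: Bracket a u] = irr u.
Proof. by rewrite irr_cons /= !andbT. Qed.

Lemma irr_cat s t :
  irr (s ++ t) = [&& irr s, irr t & ~~ (ends_bracket s && starts_bracket t)].
Proof.
elim: s => [|l s IHs]; first by rewrite /= andbT.
rewrite cat_cons !irr_cons IHs; move: (irr s) (irr t) (irr_letter l) => i j e.
case: s {IHs} => [|l' s] /=.
  by case: e i j (is_bracket l) (starts_bracket t) => [] [] [] [] [].
rewrite -/(ends_bracket (l' :: s)).
by case: e i j (is_bracket l) (is_bracket l') (ends_bracket (l' :: s))
  (starts_bracket t) => [] [] [] [] [] [] [].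
Qed.

Lemma starts_bracket_cat s t :
  starts_bracket (s ++ t) =
    if s is [::] then starts_bracket t else starts_bracket s.
Proof. by case: s. Qed.

Lemma ends_bracket_cat s t :
  ends_bracket (s ++ t) = if t is [::] then ends_bracket s else ends_bracket t.
Proof.
elim: s => [|l s IHs]; first by case: t.
rewrite cat_cons /=; case: s IHs => [|l' s] /= ->; by case: t.
Qed.

Lemma irr_vars (s : seq X) : irr (map (Var W) s).
Proof. by elim: s => // x s IHs; rewrite /= irr_cons IHs. Qed.

Lemma starts_bracket_vars (s : seq X) : starts_bracket (map (Var W) s) = false.
Proof. by case: s. Qed.

Lemma ends_bracket_vars (s : seq X) : ends_bracket (map (Var W) s) = false.
Proof. by elim: s => // x [|y s]. Qed.

(** ** Irreducible words are the words of the alternating products *)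

Section Alternating.
Variable Z : set word.
Local Notation SX := (@free_semigroup_X X W).
Local Notation ZB := (set_bracket Z).

Lemma set_mul_cat (U V : set word) s t :
  U (FMonom s) -> V (FMonom t) -> set_mul U V (FMonom (s ++ t)).
Proof. by move=> Us Vt; exists (FMonom s) => //; exists (FMonom t); rewrite ?fm_mul. Qed.

Lemma set_mulP (U V : set word) s : set_mul U V (FMonom s) ->
  exists u v, [/\ s = u ++ v, U (FMonom u) & V (FMonom v)].
Proof.
case=> -[u] Uu [[v] Vv] /=; rewrite fm_mul => -[<-].
by exists u, v.
Qed.

Lemma set_bracketP s :
  ZB (FMonom s) -> exists a u, s = [:: Bracket a u] /\ Z (FMonom u).
Proof. by case=> a _ [[u] Zu] /=; rewrite fm_bracket => -[<-]; exists a, u. Qed.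

Lemma set_bracket_letter a u : Z (FMonom u) -> ZB (FMonom [:: Bracket a u]).
Proof. by move=> Zu; exists a => //; exists (FMonom u) => //; rewrite fm_bracket. Qed.

Lemma free_semigroup_cons x s : SX (FMonom s) -> SX (FMonom (Var W x :: s)).
Proof. by case=> t tN [<-]; exists (x :: t). Qed.

Lemma free_semigroup1 x : SX (FMonom [:: Var W x]).
Proof. by exists [:: x]. Qed.

Lemma set_mulA (U V T : set word) : set_mul U (set_mul V T) = set_mul (set_mul U V) T.
Proof.
apply/seteqP; split=> -[s] /set_mulP[u [v [-> Uu]]] => [/set_mulP[v' [t [-> Vv' Tt]]]|Tv].
  by rewrite catA; do 2?apply: set_mul_cat.
by case/set_mulP: Uu => u' [v' [-> Uu' Vv']]; rewrite -catA; do 2?apply: set_mul_cat.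
Qed.

Lemma set_mul1 (U : set word) : set_mul [set 1%M] U = U.
Proof.
apply/seteqP; split=> [_ [_ -> [u Uu <-]]|u Uu]; first by rewrite mul1m.
by exists 1%M => //; exists u; rewrite ?mul1m.
Qed.

Lemma set_mulr1 (U : set word) : set_mul U [set 1%M] = U.
Proof.
apply/seteqP; split=> [_ [u Uu [_ -> <-]]|u Uu]; first by rewrite mulm1.
by exists u => //; exists 1%M; rewrite ?mulm1.
Qed.

(** U (V U)^r = (U V)^r U: how a bracket in front turns an alternating product
    that starts with a letter of [X] into one that starts with a bracket. *)
Lemma set_mul_exp_comm (U V : set word) r :
  set_mul U (set_exp (set_mul V U) r) = set_mul (set_exp (set_mul U V) r) U.
Proof.
elim: r => [|r IHr] /=; first by rewrite set_mul1 set_mulr1.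
by rewrite -!set_mulA -IHr !set_mulA.
Qed.

(** Prefixing a letter of [X] to a word that begins with one only lengthens its
    first block of letters. *)
Definition absorbs x (V : set word) :=
  forall s, V (FMonom s) -> V (FMonom (Var W x :: s)).

Lemma absorbs_mul x (U V : set word) : absorbs x U -> absorbs x (set_mul U V).
Proof.
move=> Ux s /set_mulP[u [v [-> Uu Vv]]]; rewrite -cat_cons.
by apply: set_mul_cat => //; apply: Ux.
Qed.

Definition letter_in l := if l is Bracket _ u then `[< Z (FMonom u) >] else true.

Lemma alternating_var x s : irr (Var W x :: s) -> all letter_in s ->
  (exists2 r, (0 < r)%N & set_exp (set_mul SX ZB) r (FMonom (Var W x :: s)))
  \/ (exists r, set_mul (set_exp (set_mul SX ZB) r) SX (FMonom (Var W x :: s))).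
Proof.
have [n] := ubnP (size s); elim: n x s => // n IHn x [|[y|a u] s] /= sn irr_s sZ.
- by right; exists 0%N; rewrite set_mul1; apply: free_semigroup1.
- have absSX := @free_semigroup_cons x.
  have irr_ys : irr (Var W y :: s) by move: irr_s; rewrite irr_cons => /and3P[].
  case: (IHn y s sn irr_ys sZ) => [[[//|r] _ ys]|[r ys]].
  + by left; exists r.+1 => //; apply: absorbs_mul ys; apply: absorbs_mul.
  + right; exists r; move: ys; case: r => [|r]; first by rewrite !set_mul1; apply: absSX.
    by apply/absorbs_mul/absorbs_mul/absorbs_mul.
have /andP[/asboolP Zu {}sZ] := sZ.
have xu : set_mul SX ZB (FMonom [:: Var W x; Bracket a u]).
  by apply: (@set_mul_cat _ _ [:: _] [:: _]);
    [apply: free_semigroup1|apply: set_bracket_letter].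
case: s sn irr_s sZ => [|[y|b v] s] sn irr_s sZ.
- by left; exists 1%N; rewrite //= set_mulr1.
- have irr_ys : irr (Var W y :: s).
    by move: irr_s; rewrite [irr (Var W x :: _)]irr_cons irr_cons => /and3P[_ /and3P[]].
  case: (IHn y s (ltnW sn) irr_ys sZ) => [[r _ ys]|[r ys]].
  + by left; exists r.+1 => //; apply: (@set_mul_cat _ _ [:: _; _]).
  + by right; exists r.+1; rewrite /= -set_mulA; apply: (@set_mul_cat _ _ [:: _; _]).
- by move: irr_s; rewrite !irr_cons /= !andbF.
Qed.

Lemma irr_Lambda s : irr s -> all letter_in s -> Lambda SX Z (FMonom s).
Proof.
case: s => [|[x|a u] s] irr_s sZ; first by right; rewrite /= fm_one.
  by case: (alternating_var irr_s sZ) => [[r r0 rs]|[r rs]];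
    do 3 left; [left|right]; exists r.
have /andP[/asboolP Zu {}sZ] := sZ.
have ZBu : ZB (FMonom [:: Bracket a u]) by exact: set_bracket_letter.
case: s irr_s sZ => [|[x|b v] s] irr_s sZ.
- by left; right; exists 0%N => //; rewrite set_mul1.
- have {}irr_s : irr (Var W x :: s) by move: irr_s; rewrite irr_cons => /and3P[].
  case: (alternating_var irr_s sZ) => [[r r0 rs]|[r rs]].
    left; right; exists r => //; rewrite -set_mul_exp_comm.
    exact: (@set_mul_cat _ _ [:: _]).
  do 2 left; right; exists r.+1 => //=; rewrite -set_mulA set_mul_exp_comm.
  exact: (@set_mul_cat _ _ [:: _]).
- by move: irr_s; rewrite !irr_cons /= !andbF.
Qed.

Lemma Lambda_irr s :
  (forall u, Z (FMonom u) -> irr u) -> Lambda SX Z (FMonom s) -> irr s.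
Proof.
move=> Zirr.
have SXP u : SX (FMonom u) ->
    [/\ irr u, ~~ starts_bracket u, ~~ ends_bracket u & u <> [::]].
  case=> t tN [<-]; rewrite irr_vars starts_bracket_vars ends_bracket_vars.
  by split=> //; case: t tN.
have ZBP u : ZB (FMonom u) -> irr u.
  by move=> /set_bracketP[a [v [-> /Zirr]]]; rewrite irr_bracket.
have one_nil u : FMonom u = 1%M -> u = [::] by rewrite fm_one => -[].
(* Each kind of alternating product keeps one end free of brackets, so that
   blocks can be concatenated there. *)
have YZ r u : set_exp (set_mul SX ZB) r (FMonom u) -> irr u /\ ~~ starts_bracket u.
  elim: r u => [|r IHr] u /=; first by move=> /one_nil ->.
  case/set_mulP=> _ [v [-> /set_mulP[y [z [-> /SXP[y1 y2 y3 yN] /ZBP z1]]] /IHr[v1 v2]]].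
  rewrite !irr_cat y1 z1 v1 (negbTE y3) (negbTE v2) andbF -catA starts_bracket_cat.
  by case: y y2 yN {y1 y3}.
have ZY r u : set_exp (set_mul ZB SX) r (FMonom u) -> irr u /\ ~~ ends_bracket u.
  elim: r u => [|r IHr] u /=; first by move=> /one_nil ->.
  case/set_mulP=> _ [v [-> /set_mulP[z [y [-> /ZBP z1 /SXP[y1 y2 y3 yN]]]] /IHr[v1 v2]]].
  rewrite !irr_cat y1 z1 v1 !ends_bracket_cat (negbTE y2) andbF.
  case: y y3 yN {y1 y2} => // l y y3 _; rewrite (negbTE y3) /=.
  by case: v v2 {v1}.
case=> [[[[|]|]|]|/one_nil -> //].
- by case=> r _ /YZ[].
- case=> r _ /set_mulP[u [v [-> /YZ[u1 _] /SXP[v1 v2 _ _]]]].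
  by rewrite irr_cat u1 v1 (negbTE v2) andbF.
- by case=> r _ /ZY[].
- case=> r _ /set_mulP[u [v [-> /ZY[u1 u2] /ZBP v1]]].
  by rewrite irr_cat u1 v1 (negbTE u2).
Qed.

End Alternating.

Lemma frakX_irr n s : frakX n (FMonom s) -> irr s.
Proof.
elim: n s => [|n IHn] s /=; last exact: Lambda_irr.
by case=> t _ [<-]; apply: irr_vars.
Qed.

Lemma irr_frakX n s : (weight s <= n)%N -> irr s -> frakX n (FMonom s).
Proof.
elim: n s => [|n IHn] s sn irr_s.
  by case: s sn irr_s => [|[x|a u] s] // _ _; exists [::].
apply: irr_Lambda => //; elim: s sn irr_s => //= l s IHs.
rewrite irr_cons => sn /and3P[l1 s1 _]; apply/andP; split; last first.
  by apply: IHs => //; apply: leq_trans sn; case: l {l1} => [x|a u]; rewrite weightE; lia.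
case: l l1 sn => // a u u1; rewrite weightE => sn; apply/asboolP/IHn => //.
by move: sn; lia.
Qed.

(** The number of vertices of a word bounds the nesting of its brackets, hence
    the stage at which it appears. *)
Lemma frakX_ooE s : frakX_oo (FMonom s) <-> irr s.
Proof.
split=> [[n _]|irr_s]; first exact: frakX_irr.
by exists (weight s) => //; apply: irr_frakX.
Qed.

End IrreducibleWords.

(** * The decomposition of the free operated algebra *)

Section Decomposition.
Context (k : comNzRingType) (X W : Type) (lam : W -> k).

Local Notation letter := (letter X W).
Local Notation word := (word X W).
Local Notation kM := {malg k[word]}.
Local Notation P a := (malg_map (bracket (X := X) a) : kM -> kM).
Local Notation nf := (@nf k X W lam).
Local Notation kword := (@kword k X W).
Local Notation rb_step := (@rb_step k X W lam).
Local Notation IdS := (@IdS k X W lam).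

Implicit Types (s t u v : seq letter) (a b : W) (l : letter) (p q : kM).

Definition nf_lin : kM -> kM := lin_ext (fun m : word => nf m).

Lemma nf_lin_linear : linear nf_lin.
Proof. exact: lin_ext_linear. Qed.

Lemma nf_lin_kword s : nf_lin (kword s) = nf s.
Proof. by rewrite /nf_lin lin_extU. Qed.

Lemma P_linear a : linear (P a).
Proof. exact: malg_map_linear. Qed.

Lemma nf_lin_P a p : nf_lin (P a p) = P a (nf_lin p).
Proof.
move: p; apply: kword_ind => [|c p q IHp IHq|s].
- by rewrite (raw_linear0 (P_linear a)) !(raw_linear0 nf_lin_linear)
    (raw_linear0 (P_linear a)).
- by rewrite P_linear !nf_lin_linear P_linear IHp IHq.
- by rewrite P_kword !nf_lin_kword nf_bracket // nf_nil mulr1.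
Qed.

(** ** Normal forms kill the relations *)

(** The operated ideal of the relations, presented by its spanning set: a
    relation in a context is a word minus its three reducts. *)
Inductive rb_span : set kM :=
  | rb_span0 : rb_span 0
  | rb_span_lin c p q : rb_span p -> rb_span q -> rb_span (c *: p + q)
  | rb_span_step s t1 t2 t3 c : rb_step s t1 t2 t3 c ->
      rb_span (kword s - kword t1 - kword t2 - c *: kword t3).

Lemma nf_lin_rb_span p : rb_span p -> nf_lin p = 0.
Proof.
elim=> [|c p' q _ IHp _ IHq|s t1 t2 t3 c st].
- exact: raw_linear0 nf_lin_linear.
- by rewrite nf_lin_linear IHp IHq scaler0 addr0.
- rewrite (raw_linear_relation nf_lin_linear) !nf_lin_kword (nf_step st).
  exact: lin3_sub.
Qed.

Lemma rb_span_map (f : kM -> kM) (g : seq letter -> seq letter) : linear f ->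
  (forall s, f (kword s) = kword (g s)) ->
  (forall s t1 t2 t3 c, rb_step s t1 t2 t3 c ->
     rb_step (g s) (g t1) (g t2) (g t3) c) ->
  forall p, rb_span p -> rb_span (f p).
Proof.
move=> fl fw fs p; elim=> [|c p' q _ IHp _ IHq|s t1 t2 t3 c st].
- by rewrite (raw_linear0 fl); exact: rb_span0.
- by rewrite fl; apply: rb_span_lin.
- rewrite (raw_linear_relation fl) !fw.
  by apply: rb_span_step; apply: fs.
Qed.

Lemma rb_span_mull p q : rb_span q -> rb_span (p * q).
Proof.
move=> qI; move: p; apply: kword_ind => [|c p p' IHp IHp'|s].
- by rewrite mul0r; exact: rb_span0.
- by rewrite malg_mull_linear; apply: rb_span_lin.
- apply: (rb_span_map (g := cat s)) qI => [|t|t t1 t2 t3 c].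
  + exact: malg_mulr_linear.
  + exact: kwordM.
  + exact: rb_step_catl.
Qed.

Lemma rb_span_mulr p q : rb_span p -> rb_span (p * q).
Proof.
move=> pI; move: q; apply: kword_ind => [|c q q' IHq IHq'|s].
- by rewrite mulr0; exact: rb_span0.
- by rewrite malg_mulr_linear; apply: rb_span_lin.
- apply: (rb_span_map (f := fun p => p * kword s) (g := cat^~ s)) pI => [|t|t t1 t2 t3 c].
  + exact: malg_mull_linear.
  + exact: kwordM.
  + exact: rb_step_catr.
Qed.

Lemma rb_span_P a p : rb_span p -> rb_span (P a p).
Proof.
apply: (rb_span_map (f := P a) (g := fun s => [:: Bracket a s])) => [|t|t t1 t2 t3 c].
- exact: P_linear.
- exact: P_kword.
- exact: rb_in.
Qed.

Lemma rb_span_ideal : operated_ideal (rb_span : set (kM_alg k X W)).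
Proof.
split; [exact: rb_span0 | exact: rb_span_lin | exact: rb_span_mull
  | exact: rb_span_mulr | exact: rb_span_P].
Qed.

Lemma RB_relation_kword a u b v :
  << (bracket a (FMonom u) * bracket b (FMonom v))%M >>
    - << bracket a (FMonom u * bracket b (FMonom v))%M >>
    - << bracket b (bracket a (FMonom u) * FMonom v)%M >>
    - lam b *: << bracket a (FMonom u * FMonom v)%M >>
  = kword [:: Bracket a u; Bracket b v]
    - kword [:: Bracket a (u ++ [:: Bracket b v])]
    - kword [:: Bracket b (Bracket a u :: v)] - lam b *: kword [:: Bracket a (u ++ v)].
Proof. by rewrite !(fm_mul, fm_bracket). Qed.

Lemma nf_lin_IdS p : IdS p -> nf_lin p = 0.
Proof.
move=> pI; apply: nf_lin_rb_span; apply: (pI _ rb_span_ideal).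
move=> _ [[u] [[v] [a [b ->]]]]; rewrite RB_relation_kword.
exact/rb_span_step/rb_here.
Qed.

Lemma IdS_ideal : operated_ideal (IdS : set (kM_alg k X W)).
Proof.
split=> [I Iid SI|c p q pI qI I Iid SI|p q qI I Iid SI|p q pI I Iid SI|a p pI I Iid SI].
- exact: oi_zero.
- by apply: (oi_linear Iid); [apply: pI|apply: qI].
- by apply: (oi_mull Iid); apply: qI.
- by apply: (oi_mulr Iid); apply: pI.
- by apply: (oi_P Iid); apply: pI.
Qed.

Lemma IdS0 : IdS 0. Proof. exact: oi_zero IdS_ideal. Qed.
Lemma IdSD p q : IdS p -> IdS q -> IdS (p + q).
Proof. by move=> pI /(oi_linear IdS_ideal 1 pI); rewrite scale1r. Qed.
Lemma IdSZ c p : IdS p -> IdS (c *: p).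
Proof. by move=> pI; have := oi_linear IdS_ideal c pI IdS0; rewrite addr0. Qed.
Lemma IdS_mull p q : IdS q -> IdS (p * q).
Proof. exact: (oi_mull IdS_ideal). Qed.
Lemma IdS_mulr p q : IdS p -> IdS (p * q).
Proof. exact: (oi_mulr IdS_ideal). Qed.
Lemma IdS_P a p : IdS p -> IdS (P a p).
Proof. exact: (oi_P IdS_ideal). Qed.

Lemma IdS_relation a u b v :
  IdS (kword [:: Bracket a u; Bracket b v]
    - kword [:: Bracket a (u ++ [:: Bracket b v])]
    - kword [:: Bracket b (Bracket a u :: v)] - lam b *: kword [:: Bracket a (u ++ v)]).
Proof.
move=> I _; apply; exists (FMonom u), (FMonom v), a, b.
exact/esym/RB_relation_kword.
Qed.

Lemma IdS_mul_congr p p' q q' :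
  IdS (p - p') -> IdS (q - q') -> IdS (p * q - p' * q').
Proof.
move=> pI qI; have -> : p * q - p' * q' = (p - p') * q + p' * (q - q').
  by rewrite mulrBl mulrBr addrA subrK.
by apply: IdSD; [apply: IdS_mulr|apply: IdS_mull].
Qed.

Lemma kword_relationM s1 s2 s3 s4 c s :
  (kword s1 - kword s2 - kword s3 - c *: kword s4) * kword s =
  kword (s1 ++ s) - kword (s2 ++ s) - kword (s3 ++ s) - c *: kword (s4 ++ s).
Proof. by rewrite (raw_linear_relation (malg_mull_linear (kword s))) !kwordM. Qed.

(** Each rewriting step subtracts a multiple of a relation. *)
Lemma IdS_nf s : IdS (kword s - nf s).
Proof.
elim/nf_ind: s => [|x s IHs|a u s s_start IHu IHs|a u b v s IH1 IH2 IH3].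
- by rewrite nf_nil kword0 subrr; exact: IdS0.
- rewrite nf_var kword_cons; apply: IdS_mul_congr => //.
  by rewrite subrr; exact: IdS0.
- rewrite nf_bracket // kword_cons; apply: IdS_mul_congr => //.
  by rewrite -P_kword -(raw_linearB (P_linear a)); apply: IdS_P.
- rewrite nf_redex.
  have := IdS_mulr (kword s) (IdS_relation a u b v).
  rewrite kword_relationM /= => rel.
  have := IdSD rel (IdSD (IdSD IH1 IH2) (IdSZ (lam b) IH3)).
  by rewrite lin3_telescope.
Qed.

Lemma IdS_nf_lin p : IdS (p - nf_lin p).
Proof.
move: p; apply: kword_ind => [|c p q IHp IHq|s].
- by rewrite (raw_linear0 nf_lin_linear) subrr; exact: IdS0.
- have -> : c *: p + q - nf_lin (c *: p + q) = c *: (p - nf_lin p) + (q - nf_lin q).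
    by rewrite nf_lin_linear scalerBr opprD addrACA.
  exact: IdSD (IdSZ c IHp) IHq.
- by rewrite nf_lin_kword; apply: IdS_nf.
Qed.

(** ** Normal forms are irreducible and irreducible words are normal *)

(** That a normal form begins with a bracket only if the word does is what
    lets the product of a bracket and of such a normal form be irreducible. *)
Definition nf_bound s : set word := [set m : word |
  [/\ irr m, (weight m <= weight s)%N & starts_bracket m -> starts_bracket s]].

Lemma nf_boundP s t : nf_bound s (FMonom t) <->
  [/\ irr t, (weight t <= weight s)%N & starts_bracket t -> starts_bracket s].
Proof. by []. Qed.

Lemma nf_bounded s : nf s \in supported_on (nf_bound s).
Proof.
elim/nf_ind: s => [|x s IHs|a u s s_start IHu IHs|a u b v s IH1 IH2 IH3].
- by rewrite nf_nil -kword0; apply: supported_onU.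
- rewrite nf_var; pose D : set word := [set FMonom [:: Var W x]].
  apply: (supportedM (D := D)) IHs; last exact: supported_onU.
  move=> _ [m] -> /nf_boundP[m1 m2 _]; rewrite fm_mul.
  by apply/nf_boundP; split; rewrite ?irr_cons ?m1.
- rewrite nf_bracket //.
  pose D : set word := fun m => exists u',
    [/\ m = FMonom [:: Bracket a u'], irr u' & (weight u' <= weight u)%N].
  apply: (supportedM (D := D)) IHs; last first.
    apply: supported_malg_map IHu => -[u'] /nf_boundP[u1 u2 _].
    by exists u'; rewrite fm_bracket.
  move=> _ [m] [u' [-> u1 u2]] /nf_boundP[m1 m2 m3].
  have m_start : starts_bracket m = false by apply: contraNF s_start.
  rewrite fm_mul; apply/nf_boundP; split=> //.
    rewrite irr_cons m1 m_start andbF andbT; exact: u1.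
  by move: u2 m2; rewrite !weightE; lia.
- have sub t : (weight t <= weight [:: Bracket a u, Bracket b v & s])%N ->
      (nf_bound t `<=` nf_bound [:: Bracket a u, Bracket b v & s])%classic.
    by move=> ts [m] /nf_boundP[m1 m2 _]; apply/nf_boundP; split;
      rewrite ?(leq_trans m2 ts).
  rewrite nf_redex addrC; apply: supported_lin.
    by apply: supported_sub IH3; apply: sub; rewrite !weightE; lia.
  rewrite -[X in X + _]scale1r; apply: supported_lin.
    by apply: supported_sub IH1; apply: sub; rewrite !weightE; lia.
  by apply: supported_sub IH2; apply: sub; rewrite !weightE; lia.
Qed.

Lemma nf_irr s : irr s -> nf s = kword s.
Proof.
elim/nf_ind: s => [|x s IHs|a u s s_start IHu IHs|a u b v s IH1 IH2 IH3].
- by rewrite nf_nil kword0.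
- by rewrite irr_cons nf_var => /and3P[_ s1 _]; rewrite IHs // -kword_cons.
- rewrite irr_cons nf_bracket // => /and3P[u1 s1 _].
  by rewrite IHs // IHu // P_kword -kword_cons.
- by rewrite !irr_cons /= !andbF.
Qed.

Lemma nf_lin_supported p : nf_lin p \in supported_on (@frakX_oo X W).
Proof.
move: p; apply: kword_ind => [|c p q IHp IHq|s].
- by rewrite (raw_linear0 nf_lin_linear) supported0.
- by rewrite nf_lin_linear; exact: supported_lin IHp IHq.
- rewrite nf_lin_kword; apply: supported_sub (nf_bounded s) => -[m] /nf_boundP[m1 _ _].
  exact/frakX_ooE.
Qed.

Lemma nf_lin_id p : p \in supported_on (@frakX_oo X W) -> nf_lin p = p.
Proof.
move: p; apply: supported_ind => [|c p q IHp IHq|[s] /frakX_ooE s1].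
- exact: raw_linear0 nf_lin_linear.
- by rewrite nf_lin_linear IHp IHq.
- by rewrite nf_lin_kword nf_irr.
Qed.

(** [nf_lin p] is one element of the span of irreducible words congruent to [p];
    any other differs from it by an element of the ideal that [nf_lin] fixes
    and kills. *)
Lemma phiE p : val (phi lam p) = nf_lin p.
Proof.
have pphi : IdS (p - val (phi lam p)).
  rewrite /phi; case: xgetP => [v -> //|/(_ (KSpan (nf_lin_supported p)))].
  by case; apply: IdS_nf_lin.
apply/eqP; rewrite eq_sym -subr_eq0 -[val _]nf_lin_id ?kspanP //.
by rewrite -(raw_linearB nf_lin_linear) nf_lin_IdS.
Qed.

End Decomposition.

(** * Generalities on operated algebras *)

Section OperatedAlgebraTheory.
Context (k : comNzRingType) (W : Type).
Implicit Types A B C : opData k W.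

Lemma operated_hom_comp A B C (f : A -> B) (g : B -> C) :
  operated_hom f -> operated_hom g -> operated_hom (g \o f).
Proof.
move=> [fl fM f1 fP] [gl gM g1 gP]; split=> [c x y|x y||w x] /=.
- by rewrite fl gl.
- by rewrite fM gM.
- by rewrite f1 g1.
- by rewrite fP gP.
Qed.

Lemma surj_operated_algebra A B (f : A -> B) :
  operated_algebra A -> operated_hom f -> (forall y, exists x, f x = y) ->
  operated_algebra B.
Proof.
move=> Aalg [fl fM f1 fP] fS; split.
- move=> x y z; have [x' <-] := fS x; have [y' <-] := fS y; have [z' <-] := fS z.
  by rewrite -!fM (oa_mulA Aalg).
- by move=> x; have [x' <-] := fS x; rewrite -f1 -fM (oa_mul1l Aalg).
- by move=> x; have [x' <-] := fS x; rewrite -f1 -fM (oa_mul1r Aalg).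
- move=> y c x z; have [x' <-] := fS x; have [y' <-] := fS y; have [z' <-] := fS z.
  by rewrite -fl -!fM (oa_linearl Aalg) fl.
- move=> y c x z; have [x' <-] := fS x; have [y' <-] := fS y; have [z' <-] := fS z.
  by rewrite -fl -!fM (oa_linearr Aalg) fl.
- move=> w c x z; have [x' <-] := fS x; have [z' <-] := fS z.
  by rewrite -fl -!fP (oa_linearP Aalg) fl.
Qed.

(** Bilinear identities are inherited by homomorphic images. *)
Lemma surj_matching_RB (lam : W -> k) A B (f : A -> B) :
  operated_algebra A -> operated_hom f -> (forall y, exists x, f x = y) ->
  (forall a b (x y : A), f (op_mul (op_P a x) (op_P b y)) =
     f (op_P a (op_mul x (op_P b y)) + op_P b (op_mul (op_P a x) y)
        + lam b *: op_P a (op_mul x y))) ->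
  matching_RB_algebra lam B.
Proof.
move=> Aalg fH fS fRB; split=> [|a b x y]; first exact: surj_operated_algebra fH fS.
have [fl fM _ fP] := fH; have [x' <-] := fS x; have [y' <-] := fS y.
by rewrite -!fP -!fM -!fP fRB !(raw_linearD fl) (raw_linearZ fl).
Qed.

(** A homomorphism constant on the fibres of a surjective homomorphism [f]
    descends along [f], by means of any set-theoretic section [s] of [f]. *)
Lemma operated_hom_factor A B C (f : A -> C) (s : C -> A) (g : A -> B) :
  operated_hom f -> cancel s f -> operated_hom g ->
  (forall x, g (s (f x)) = g x) -> operated_hom (g \o s).
Proof.
move=> [fl fM f1 fP] sK [gl gM g1 gP] gsf; split=> [c x y|x y||w x] /=.
- by rewrite -{1}(sK x) -{1}(sK y) -fl gsf gl.
- by rewrite -{1}(sK x) -{1}(sK y) -fM gsf gM.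
- by rewrite -f1 gsf g1.
- by rewrite -{1}(sK x) -fP gsf gP.
Qed.

Lemma ker_operated_ideal A B (f : A -> B) : operated_algebra B -> operated_hom f ->
  operated_ideal [set x | f x = 0].
Proof.
move=> Balg [fl fM f1 fP]; split=> [|c x y /= fx fy|x y /= fy|x y /= fx|w x /= fx].
- exact: raw_linear0.
- by rewrite fl fx fy scaler0 addr0.
- by rewrite fM fy (raw_linear0 (oa_linearr Balg _)).
- by rewrite fM fx (raw_linear0 (oa_linearl Balg _)).
- by rewrite fP fx (raw_linear0 (oa_linearP Balg _)).
Qed.

Lemma malg_operated_algebra (K : monomType) (h : W -> K -> K) :
  operated_algebra (@OpData k W {malg k[K]} *%R 1 (fun w => malg_map (h w))).
Proof.
split=> [x y z|x|x|y|x|w] /=.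
- exact: mulrA.
- exact: mul1r.
- exact: mulr1.
- exact: malg_mull_linear.
- exact: malg_mulr_linear.
- exact: malg_map_linear.
Qed.

End OperatedAlgebraTheory.

Lemma malg_mapM (k : comNzRingType) (K K' : monomType) (h : K -> K')
    (p q : {malg k[K]}) :
  (forall m n, h (m * n)%M = (h m * h n)%M) ->
  malg_map h (p * q) = malg_map h p * malg_map h q.
Proof.
have hl := malg_map_linear (k := k) h.
move=> hM; move: p; apply: malg_ind => [|c p p' IHp IHp'|m].
- by rewrite mul0r (raw_linear0 hl) mul0r.
- by rewrite malg_mull_linear !hl IHp IHp' malg_mull_linear.
move: q; apply: malg_ind => [|c q q' IHq IHq'|n].
- by rewrite mulr0 (raw_linear0 hl) mulr0.
- by rewrite malg_mulr_linear !hl IHq IHq' malg_mulr_linear.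
- by rewrite malgUM !malg_mapU hM malgUM.
Qed.

Lemma malg_degree_bound (k : comNzRingType) (K : choiceType) (d : K -> nat)
    (p : {malg k[K]}) :
  exists n, p \in supported_on [set m | (d m <= n)%N].
Proof.
move: p; apply: malg_ind => [|c p q [i pi] [j qj]|m].
- by exists 0%N; apply: supported0.
- exists (maxn i j); apply: supported_lin.
  + by apply: supported_sub pi => m /= mi; rewrite leq_max mi.
  + by apply: supported_sub qj => m /= mj; rewrite leq_max mj orbT.
- by exists (d m); apply: supported_onU => /=.
Qed.

(** * The quotient map onto matching Rota-Baxter forests *)

Section Quotient.
Context (k : comNzRingType) (X W : Type) (lam : W -> k).

Local Notation letter := (letter X W).
Local Notation word := (word X W).
Local Notation forest := (forest X W).
Local Notation kM := {malg k[word]}.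
Local Notation P a := (malg_map (bracket (X := X) a) : kM -> kM).
Local Notation kword := (@kword k X W).
Local Notation IdS := (@IdS k X W lam).
Local Notation nf_lin := (@nf_lin k X W lam).
Local Notation Sha := (Sha_alg X lam).
Implicit Types (s t u v : seq letter) (a b : W) (l : letter) (p q : kM).

Definition to_Sha p : Sha := theta_oo (phi lam p).
Definition of_Sha (x : Sha) : kM :=
  malg_map (@word_of_forest X W) (val (x : kspan _ _)).

Lemma Sha_inj (x y : Sha) : val (x : kspan _ _) = val (y : kspan _ _) -> x = y.
Proof. exact: val_inj. Qed.

Lemma val_to_Sha p :
  val (to_Sha p : kspan _ _) = malg_map (@forest_of_word X W) (nf_lin p).
Proof. by rewrite -phiE. Qed.

Lemma to_ShaK (x : Sha) : to_Sha (of_Sha x) = x.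
Proof.
apply: Sha_inj; rewrite val_to_Sha nf_lin_id.
  by rewrite malg_map_cancel //; exact: word_of_forestK.
by apply: supported_malg_map (kspanP _) => F; exact: word_of_frakL_oo.
Qed.

Lemma of_ShaK p : of_Sha (to_Sha p) = nf_lin p.
Proof. by rewrite /of_Sha val_to_Sha malg_map_cancel //; exact: forest_of_wordK. Qed.

Lemma to_Sha_linear : linear to_Sha.
Proof.
move=> c p q; apply: Sha_inj; rewrite val_to_Sha nf_lin_linear malg_map_linear.
by rewrite -!val_to_Sha.
Qed.

Lemma to_Sha_IdS p q : IdS (p - q) -> to_Sha p = to_Sha q.
Proof.
move=> pq; apply: Sha_inj; rewrite !val_to_Sha; congr malg_map.
by apply/eqP; rewrite -subr_eq0 -(raw_linearB (@nf_lin_linear _ _ _ lam)) nf_lin_IdS.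
Qed.

(** The product of forests is defined by projecting the product of words; this
    projection may be applied to the factors first because its kernel is an
    ideal. *)
Lemma to_Sha_mul p q : to_Sha (p * q) = op_mul (to_Sha p) (to_Sha q).
Proof.
transitivity (to_Sha (of_Sha (to_Sha p) * of_Sha (to_Sha q))); last by [].
rewrite !of_ShaK; apply: to_Sha_IdS.
exact (IdS_mul_congr (@IdS_nf_lin _ _ _ lam p) (@IdS_nf_lin _ _ _ lam q)).
Qed.

Lemma forest_of_bracket a (m : word) :
  forest_of_word (bracket a m) = graft a (forest_of_word m).
Proof. by case: m => s; rewrite fm_bracket; apply: val_inj; rewrite /= fmU. Qed.

Lemma malg_map_forest_of_bracket a p :
  malg_map (@forest_of_word X W) (P a p) =
    malg_map (@graft X W a) (malg_map (@forest_of_word X W) p).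
Proof.
move: p; apply: eq_linear_malg => [c p q|c p q|m].
- by rewrite !malg_map_linear.
- by rewrite !malg_map_linear.
- by rewrite !malg_mapU forest_of_bracket.
Qed.

Lemma to_Sha_P a p : to_Sha (P a p) = op_P a (to_Sha p).
Proof.
apply: Sha_inj; rewrite val_to_Sha nf_lin_P malg_map_forest_of_bracket.
by rewrite -val_to_Sha.
Qed.

Lemma to_Sha_hom : operated_hom (to_Sha : kM_alg k X W -> Sha).
Proof.
split=> [||/=|].
- exact: to_Sha_linear.
- exact: to_Sha_mul.
- apply: Sha_inj; rewrite val_to_Sha -kword0 nf_lin_kword nf_nil -kword0 malg_mapU /=.
  by congr << _ >>; apply: val_inj; rewrite /= fm1.
- exact: to_Sha_P.
Qed.

(** The relations are imposed on words only; by bilinearity they hold for all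
    elements. *)
Lemma IdS_RB a b p q :
  IdS (P a p * P b q - P a (p * P b q) - P b (P a p * q) - lam b *: P a (p * q)).
Proof.
have combine c x1 x2 x3 x4 y1 y2 y3 y4 d :
    (c *: x1 + y1) - (c *: x2 + y2) - (c *: x3 + y3) - d *: (c *: x4 + y4) =
    c *: (x1 - x2 - x3 - d *: x4) + (y1 - y2 - y3 - d *: y4) :> kM.
  rewrite !scalerBr !scalerDr !opprD !scalerA (mulrC d c).
  by rewrite [LHS](AC (2*2*2*2) ((1*3*5*7)*(2*4*6*8))).
move: p; apply: kword_ind => [|c p p' IHp IHp'|s].
- rewrite !(mul0r, raw_linear0 (@P_linear _ _ _ _)) scaler0 !subr0; exact: IdS0.
- rewrite !(P_linear, malg_mull_linear) combine.
  exact: IdSD (IdSZ c IHp) IHp'.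
move: q; apply: kword_ind => [|c q q' IHq IHq'|t].
- rewrite !(mulr0, raw_linear0 (@P_linear _ _ _ _)) scaler0 !subr0.
  exact: IdS0.
- rewrite !(P_linear, malg_mulr_linear) combine.
  exact: IdSD (IdSZ c IHq) IHq'.
- by rewrite !P_kword !kwordM !P_kword; apply: IdS_relation.
Qed.

Lemma Sha_matching_RB : matching_RB_algebra lam Sha.
Proof.
apply: (surj_matching_RB _ to_Sha_hom) => [|x|a b p q].
- exact: (malg_operated_algebra k (@bracket X W)).
- by exists (of_Sha x); exact: to_ShaK.
- apply: to_Sha_IdS; rewrite !opprD !addrA; exact (@IdS_RB a b p q).
Qed.

(** ** The universal property *)

Section Universal.
Context (B : opData k W) (B_RB : matching_RB_algebra lam B) (f : X -> B).
Let Balg : operated_algebra B := B_RB.1.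

Fixpoint ev_letter l : B :=
  match l with
  | Var x => f x
  | Bracket a s => op_P a (foldr (fun l' => op_mul (ev_letter l')) (op_one B) s)
  end.

Definition ev_word s : B := foldr (fun l => op_mul (ev_letter l)) (op_one B) s.

Lemma ev_word_cat s t : ev_word (s ++ t) = op_mul (ev_word s) (ev_word t).
Proof.
elim: s => [|l s IHs] /=; first by rewrite (oa_mul1l Balg).
by rewrite IHs (oa_mulA Balg).
Qed.

Lemma ev_word1 l : ev_word [:: l] = ev_letter l.
Proof. by rewrite /= (oa_mul1r Balg). Qed.

Definition ev_lin : kM -> B := lin_ext (fun m : word => ev_word m).

Lemma ev_lin_linear : linear ev_lin.
Proof. exact: lin_ext_linear. Qed.

Lemma ev_lin_kword s : ev_lin (kword s) = ev_word s.
Proof. by rewrite /ev_lin lin_extU. Qed.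

Lemma ev_lin_mul p q : ev_lin (p * q) = op_mul (ev_lin p) (ev_lin q).
Proof.
move: p; apply: eq_linear_kword => [||s].
- exact: raw_linear_comp (malg_mull_linear q) ev_lin_linear.
- exact: raw_linear_comp ev_lin_linear (oa_linearl Balg (ev_lin q)).
move: q; apply: eq_linear_kword => [||t].
- exact: raw_linear_comp (malg_mulr_linear (kword s)) ev_lin_linear.
- exact: raw_linear_comp ev_lin_linear (oa_linearr Balg (ev_lin (kword s))).
by rewrite (kwordM k s t) !ev_lin_kword ev_word_cat.
Qed.

Lemma ev_lin_P a p : ev_lin (P a p) = op_P a (ev_lin p).
Proof.
move: p; apply: eq_linear_kword => [||s].
- exact: raw_linear_comp (@P_linear k X W a) ev_lin_linear.
- exact: raw_linear_comp ev_lin_linear (oa_linearP Balg a).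
by rewrite (P_kword k a s) !ev_lin_kword ev_word1.
Qed.

Lemma ev_lin_hom : operated_hom (ev_lin : kM_alg k X W -> B).
Proof.
split; [exact: ev_lin_linear | exact: ev_lin_mul | | exact: ev_lin_P].
by rewrite /= -(kword0 k X W) ev_lin_kword.
Qed.

Lemma ev_lin_relation s1 s2 s3 s4 c :
  ev_lin (kword s1 - kword s2 - kword s3 - c *: kword s4) =
    ev_word s1 - ev_word s2 - ev_word s3 - c *: ev_word s4.
Proof. by rewrite (raw_linear_relation ev_lin_linear) !ev_lin_kword. Qed.

Lemma ev_lin_IdS p : IdS p -> ev_lin p = 0.
Proof.
move=> pI; apply: (pI _ (ker_operated_ideal Balg ev_lin_hom)).
have ev_br a u : ev_word [:: Bracket a u] = op_P a (ev_word u) by exact: ev_word1.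
move=> _ [[u] [[v] [a [b ->]]]] /=; rewrite RB_relation_kword.
rewrite ev_lin_relation.
rewrite (ev_word_cat [:: Bracket a u] [:: Bracket b v]) !ev_br.
rewrite (ev_word_cat u [:: Bracket b v]) (ev_word_cat [:: Bracket a u] v)
  (ev_word_cat u v).
rewrite !ev_br B_RB.2.
exact: lin3_sub.
Qed.

Lemma ev_lin_to_Sha p : ev_lin (of_Sha (to_Sha p)) = ev_lin p.
Proof.
rewrite of_ShaK; apply/esym/eqP; rewrite -subr_eq0 -(raw_linearB ev_lin_linear).
by rewrite ev_lin_IdS //; exact: IdS_nf_lin.
Qed.

Lemma ev_lin_of_Sha_hom : operated_hom (ev_lin \o of_Sha : Sha -> B).
Proof.
exact: operated_hom_factor to_Sha_hom to_ShaK ev_lin_hom ev_lin_to_Sha.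
Qed.

End Universal.

(** Words are generated by the letters of [X] under product and brackets, whence
    the uniqueness in the universal property. *)
Lemma operated_hom_kM_ext (B : opData k W) (g h : kM_alg k X W -> B) :
  operated_hom g -> operated_hom h ->
  (forall x, g (kword [:: Var W x]) = h (kword [:: Var W x])) -> g =1 h.
Proof.
move=> [gl gM g1 gP] [hl hM h1 hP] gh; apply: eq_linear_kword gl hl _ => s.
have [n] := ubnP (weight s).
elim: n s => // n IHn [|l s] sn; first by rewrite kword0 g1 h1.
rewrite kword_cons -[_ * _]/(op_mul (_ : kM_alg k X W) _) gM hM.
case: l sn => [x|a u]; rewrite weightE => sn.
  by rewrite gh IHn.
rewrite -P_kword -[P a _]/(op_P a (_ : kM_alg k X W)) gP hP !IHn //; by move: sn; lia.
Qed.

Lemma to_Sha_var x : to_Sha (kword [:: Var W x]) = jX lam x.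
Proof.
apply: Sha_inj; rewrite val_to_Sha nf_lin_kword nf_irr //= malg_mapU.
by congr << _ >>; apply: val_inj; rewrite /= fmU.
Qed.

Lemma Sha_free : free_matching_RB_algebra lam (jX (X := X) lam).
Proof.
split=> [|B B_RB f]; first exact: Sha_matching_RB.
exists (ev_lin f \o @of_Sha); split=> [|h [h_hom hf]].
  split=> [|x]; first exact: ev_lin_of_Sha_hom.
  by rewrite -to_Sha_var /= ev_lin_to_Sha // ev_lin_kword (ev_word1 B_RB).
apply/funext => x; rewrite -(to_ShaK x) /= ev_lin_to_Sha //.
apply: (operated_hom_kM_ext (ev_lin_hom B_RB f)
  (operated_hom_comp to_Sha_hom h_hom)).
by move=> y; rewrite /= to_Sha_var hf ev_lin_kword (ev_word1 B_RB).
Qed.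

(** * Filtrations by the number of vertices *)

Definition weight_le n : set word := [set m | (weight m <= n)%N].

Lemma nf_lin_weight_le n p :
  p \in supported_on (weight_le n) -> nf_lin p \in supported_on (weight_le n).
Proof.
move: p; apply: supported_ind => [|c p q IHp IHq|[s] sn].
- by rewrite (raw_linear0 (@nf_lin_linear _ _ _ lam)) supported0.
- by rewrite nf_lin_linear; exact: supported_lin IHp IHq.
- rewrite nf_lin_kword; apply: supported_sub (nf_bounded lam s) => -[m] /nf_boundP[_ ms _].
  exact: leq_trans ms sn.
Qed.

Lemma weight_of_forest n (F : forest) :
  forests_le n F -> weight_le n (word_of_forest F).
Proof.
move=> Fn; change (vertices (forest_of_word (word_of_forest F)) <= n)%N.
by rewrite word_of_forestK.
Qed.

Lemma Sha_filtrationE n (x : Sha) :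
  Sha_filtration X lam n x <->
  val (x : kspan _ _) \in supported_on (@forests_le X W n).
Proof.
split=> [|/supported_onP xn]; first by apply: supported_sub => F [].
apply/supported_onP => F xF; split; first exact: xn.
by move/supported_onP: (kspanP (x : kspan _ _)); apply.
Qed.

Lemma Sha_filtration_of n (x : Sha) :
  Sha_filtration X lam n x -> of_Sha x \in supported_on (weight_le n).
Proof.
by move=> /Sha_filtrationE; apply: supported_malg_map => F; exact: weight_of_forest.
Qed.

Lemma Sha_filtration_to n p :
  p \in supported_on (weight_le n) -> Sha_filtration X lam n (to_Sha p).
Proof.
move=> pn; apply/Sha_filtrationE; rewrite val_to_Sha.
apply: supported_malg_map (nf_lin_weight_le pn) => -[s] //.
Qed.

Lemma verticesM (F G : forest) : vertices (F * G)%M = (vertices F + vertices G)%N.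
Proof. by rewrite /vertices fmM map_cat sumn_cat. Qed.

Lemma vertices_graft a (F : forest) : vertices (graft a F) = (vertices F).+1.
Proof. by rewrite /vertices fmU /= addn0. Qed.

Lemma vertices1 : vertices (1%M : forest) = 0%N.
Proof. by rewrite /vertices fm1. Qed.

Lemma kF_operated_filtered : operated_filtered_algebra (kF_filtration k X W).
Proof.
split=> [|n|n c x y xn yn|n x|||i j x y xi yj|n a x xn].
- exact: (malg_operated_algebra k (@graft X W)).
- exact: supported0.
- exact: supported_lin.
- by apply: supported_sub => F /= /leqW.
- apply/seteqP; split=> // x _.
  by have [n xn] := malg_degree_bound (@vertices X W) x; exists n.
- by apply: supported_onU; rewrite /forests_le /= vertices1.
- apply: supportedM xi yj => F G /= Fi Gj.
  by rewrite /forests_le /= verticesM leq_add.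
- by apply: supported_malg_map xn => F Fn; rewrite /forests_le /= vertices_graft.
Qed.

Lemma Sha_operated_filtered : operated_filtered_algebra (Sha_filtration X lam).
Proof.
split=> [|n|n c x y xn yn|n x|||i j x y xi yj|n a x xn].
- exact: Sha_matching_RB.1.
- exact: supported0.
- exact: supported_lin.
- by apply: supported_sub => F [Fn FL]; split => //; apply: leqW.
- apply/seteqP; split=> // x _.
  have [n xn] := malg_degree_bound (@vertices X W) (val (x : kspan _ _)).
  by exists n => //; apply/Sha_filtrationE.
- by apply/Sha_filtrationE/supported_onU; rewrite /forests_le /= vertices1.
- apply: Sha_filtration_to.
  apply: supportedM (Sha_filtration_of xi) (Sha_filtration_of yj) => -[s] [t] /= si tj.
  by rewrite fm_mul /weight_le /= weightE leq_add.
- apply/Sha_filtrationE; move/Sha_filtrationE: xn; apply: supported_malg_map => F Fn.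
  by rewrite /forests_le /= vertices_graft.
Qed.

Lemma theta_inv_hom : operated_hom (@theta_inv k X W : kF_alg k X W -> kM_alg k X W).
Proof.
have l := malg_map_linear (k := k) (@word_of_forest X W).
split=> [|p q|/=|a p] /=.
- exact: l.
- apply: malg_mapM => -[s] [t]; apply: val_inj.
  by rewrite /= !fmM map_cat.
- rewrite /theta_inv malg_mapU; congr << _ >>; apply: val_inj; by rewrite /= !fm1.
- rewrite /theta_inv; move: p; apply: eq_linear_malg => [c p q|c p q|F].
  + by rewrite !malg_map_linear.
  + by rewrite !malg_map_linear.
  + rewrite !malg_mapU; congr << _ >>; apply: val_inj; by rewrite /= !fmU.
Qed.

Lemma psi_filtered_hom :
  operated_filtered_hom (kF_filtration k X W) (Sha_filtration X lam) (psi lam).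
Proof.
split.
- exact: kF_operated_filtered.
- exact: Sha_operated_filtered.
- exact: (operated_hom_comp theta_inv_hom to_Sha_hom).
- move=> n _ [p pn <-]; apply: Sha_filtration_to.
  by apply: supported_malg_map pn => F; exact: weight_of_forest.
Qed.

End Quotient.

Theorem proposition3p12 (k : comNzRingType) (X Omega : Type)
    (Omega_nonempty : inhabited Omega) (lam : Omega -> k) :
  free_matching_RB_algebra lam (jX (X := X) lam)
  /\ operated_filtered_algebra (Sha_filtration X lam)
  /\ operated_filtered_hom (kF_filtration k X Omega) (Sha_filtration X lam)
       (psi lam).
Proof.
split; first exact: Sha_free.
split; first exact: Sha_operated_filtered.
exact: psi_filtered_hom.
Qed.
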